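(* Let $T\in{\rm Aut}(X,\mathcal B,\mu)$ be ergodic and suppose the topological lens $(C_2(\mu),\widetilde T)$ is distal. Then $T$ has discrete spectrum, and consequently $\widetilde T$ is equicontinuous.
   Context: $C_2(\mu)$: probability measures on $X\times X$ with both marginals $\mu$, with the compact metrizable topology $\rho_n\to\rho$ iff $\rho_n(A\times B)\to\rho(A\times B)$ for all measurable $A,B$; $\widetilde T(\rho)(A\times B)=\rho(T^{-1}A\times T^{-1}B)$. A homeomorphism $R$ of a compact metric space $Z$ is distal if for every pair of distinct points $z_1,z_2$ the closure of the $R\times R$-orbit of $(z_1,z_2)$ is disjoint from the diagonal of $Z\times Z$; equicontinuous if $\{R^n:n\in\mathbb Z\}$ is an equicontinuous family. $T$ has discrete spectrum if $L^2(\mu)$ is spanned by eigenfunctions of $U_Tf=f\circ T$. *)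

(* Defs.v *)
From mathcomp Require Import all_boot all_algebra.
From mathcomp Require Import all_classical all_reals all_analysis.
Import GRing.Theory Num.Theory.

Set Implicit Arguments.
Unset Strict Implicit.
Unset Printing Implicit Defensive.

Local Open Scope classical_set_scope.
Local Open Scope ring_scope.

(* (X, measurable) is a standard Borel space: Borel isomorphic to a
   (necessarily Borel) subset of the real line. *)
Definition standard_borel d (X : measurableType d) (R : realType) : Prop :=
  exists f : X -> R, injective f /\ measurable_fun setT f /\
    forall A : set X, measurable A -> measurable (f @` A).

Definition is_aut d (X : measurableType d) (R : realType)
  (mu : probability X R) (T Tinv : X -> X) : Prop :=
  [/\ measurable_fun setT T, measurable_fun setT Tinv,
      cancel T Tinv, cancel Tinv T &
      forall A : set X, measurable A -> mu (T @^-1` A) = mu A].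

Definition ergodic d (X : measurableType d) (R : realType)
  (mu : probability X R) (T : X -> X) : Prop :=
  forall A : set X, measurable A -> T @^-1` A = A ->
    mu A = 0%E \/ mu A = 1%E.

Definition Tpow (X : Type) (T Tinv : X -> X) (n : int) : X -> X :=
  match n with
  | Posz k => iter k T
  | Negz k => iter k.+1 Tinv
  end.

Definition coupling d (X : measurableType d) (R : realType)
  (mu : probability X R) (rho : probability (X * X)%type R) : Prop :=
  forall A : set X, measurable A ->
    rho (A `*` setT) = mu A /\ rho (setT `*` A) = mu A.

(* values on rectangles of rho and of (T~)^n rho *)
Definition rect d (X : measurableType d) (R : realType)
  (rho : probability (X * X)%type R) (A B : set X) : \bar R := rho (A `*` B).

Definition tilde_rect d (X : measurableType d) (R : realType)
  (T Tinv : X -> X) (n : int) (rho : probability (X * X)%type R)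
  (A B : set X) : \bar R :=
  rho ((Tpow T Tinv n @^-1` A) `*` (Tpow T Tinv n @^-1` B)).

(* basic entourage of the topology of C_2(mu): the values on the k
   measurable rectangles A i x B i (i < k) differ by less than e *)
Definition near_rect (X : Type) (R : realType) (k : nat) (A B : nat -> set X)
  (e : R) (f g : set X -> set X -> \bar R) : Prop :=
  forall i, (i < k)%N -> (`| f (A i) (B i) - g (A i) (B i) | < e%:E)%E.

Definition meas_family d (X : measurableType d) (A B : nat -> set X) : Prop :=
  forall i, measurable (A i) /\ measurable (B i).

(* (C_2(mu), T~) is distal: for distinct rho1, rho2, no point (sigma, sigma)
   of the diagonal lies in the closure of the orbit {((T~)^n rho1, (T~)^n rho2)} *)
Definition lens_distal d (X : measurableType d) (R : realType)
  (mu : probability X R) (T Tinv : X -> X) : Prop :=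
  forall rho1 rho2 : probability (X * X)%type R,
    coupling mu rho1 -> coupling mu rho2 ->
    (exists E, measurable E /\ rho1 E <> rho2 E) ->
    ~ exists sigma : probability (X * X)%type R, coupling mu sigma /\
        forall (k : nat) (A B : nat -> set X) (e : R),
          meas_family A B -> 0 < e ->
          exists n : int,
            near_rect k A B e (tilde_rect T Tinv n rho1) (rect sigma) /\
            near_rect k A B e (tilde_rect T Tinv n rho2) (rect sigma).

Definition lens_equicontinuous d (X : measurableType d) (R : realType)
  (mu : probability X R) (T Tinv : X -> X) : Prop :=
  forall rho : probability (X * X)%type R, coupling mu rho ->
  forall (k : nat) (A B : nat -> set X) (e : R),
    meas_family A B -> 0 < e ->
    exists (k' : nat) (A' B' : nat -> set X) (e' : R),
      [/\ meas_family A' B', 0 < e' &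
        forall rho' : probability (X * X)%type R, coupling mu rho' ->
          near_rect k' A' B' e' (rect rho) (rect rho') ->
          forall n : int,
            near_rect k A B e (tilde_rect T Tinv n rho) (tilde_rect T Tinv n rho')].

(* Complex-valued functions are represented by pairs (real part, imaginary part). *)
Definition L2c d (X : measurableType d) (R : realType) (mu : probability X R)
  (h1 h2 : X -> R) : Prop :=
  [/\ measurable_fun setT h1, measurable_fun setT h2 &
      (\int[mu]_x ((h1 x) ^+ 2 + (h2 x) ^+ 2)%:E < +oo)%E].

(* h = h1 + i h2 is an eigenfunction of U_T : f |-> f o T, with eigenvalue a + i b *)
Definition eigenfunction d (X : measurableType d) (R : realType)
  (mu : probability X R) (T : X -> X) (h1 h2 : X -> R) : Prop :=
  [/\ L2c mu h1 h2,
      ~ {ae mu, forall x, h1 x = 0 /\ h2 x = 0} &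
      exists a b : R, {ae mu, forall x,
          h1 (T x) = a * h1 x - b * h2 x /\ h2 (T x) = a * h2 x + b * h1 x}].

(* L^2(mu) (complex) is the closed linear span of the eigenfunctions of U_T:
   every g in L^2 is approximated in L^2 norm by finite complex linear
   combinations sum_i (c_i + i d_i) (f1_i + i f2_i) of eigenfunctions. *)
Definition discrete_spectrum d (X : measurableType d) (R : realType)
  (mu : probability X R) (T : X -> X) : Prop :=
  forall g1 g2 : X -> R, L2c mu g1 g2 -> forall e : R, 0 < e ->
    exists (k : nat) (f1 f2 : nat -> X -> R) (c dd : nat -> R),
      (forall i, (i < k)%N -> eigenfunction mu T (f1 i) (f2 i)) /\
      (\int[mu]_x
         ((g1 x - \sum_(i < k) (c i * f1 i x - dd i * f2 i x)) ^+ 2 +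
          (g2 x - \sum_(i < k) (c i * f2 i x + dd i * f1 i x)) ^+ 2)%:E
        < e%:E)%E.

(* Main.v *)
(** Let AP be the closed subspace of L^2(mu) of functions with norm-precompact orbit under
    U f = f o T.  If f is not a flight vector (0 is not a weak cluster point of its orbit),
    then averaging \sum_g U^n g (x) U^n g over n yields a Hilbert-Schmidt operator H commuting
    with U such that <H f, f> > 0; since H f is almost periodic, every f orthogonal to AP is a
    flight vector.  The projection onto AP preserves boundedness, so if some indicator were
    not almost periodic there would be a bounded f <> 0 of mean zero orthogonal to AP, and the
    couplings mu x mu and (1 + f (x) f) (mu x mu) would be proximal under T~.  Hence AP is all
    of L^2(mu), which gives equicontinuity at once.  Discrete spectrum follows because H, being
    compact, symmetric and nonzero on the orthogonal complement of the eigenfunctions as soon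
    as this complement is nonzero, has there a U-invariant eigenspace, on which U + U^-1 has an
    eigenvector. *)

Require Import Defs.
From HB Require Import structures.
From mathcomp Require Import all_boot all_order all_algebra.
From mathcomp Require Import all_classical all_reals all_analysis.
From mathcomp Require Import measurable_realfun ring lra.
Import Order.TTheory GRing.Theory Num.Theory.
Import numFieldTopology.Exports numFieldNormedType.Exports.

Set Implicit Arguments.
Unset Strict Implicit.
Unset Printing Implicit Defensive.

Local Open Scope classical_set_scope.
Local Open Scope ring_scope.

(** * Semi-inner product spaces *)

(** [L2] consists of functions, not of classes modulo null sets: composition with T and truncation
    are then pointwise and satisfy their laws exactly, but the inner product is only semi-definite.
    Limits, and operators obtained as limits, are determined only up to vectors of square norm 0, so
    commutation and eigenvalue equations are stated as a vanishing [sqn] or tested against an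
    arbitrary vector. Scalars are real, so U, which need not be symmetric, gives way to U + U^-1
    when a variational argument has to produce eigenvectors. No tensor product is built:
    Hilbert-Schmidt operators occur only as finite weighted lists of vectors, and the average over n
    is replaced by nearly minimal elements of a convex hull. The bound |f| <= 1 keeps 1 + f(x) f(y)
    nonnegative and mean zero makes both marginals equal to mu. After n steps the twisted coupling
    takes on A x B the value mu(A) mu(B) + <f, U^n 1_A> <f, U^n 1_B>, so smallness of finitely many
    inner products at one time n brings it near mu x mu. *)

Record semi_inner_product (R : realType) (V : lmodType R) := SemiInnerProduct {
  dot :> V -> V -> R ;
  dotC : forall u v, dot u v = dot v u ;
  dotDl : forall u v w, dot (u + v) w = dot u w + dot v w ;
  dotZl : forall a u v, dot (a *: u) v = a * dot u v ;
  dot_ge0 : forall u, 0 <= dot u u }.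

Section SemiInnerProductTheory.
Context (R : realType) (V : lmodType R) (ip : semi_inner_product V).
Implicit Types (u v w : V) (a b e : R).

Lemma dotDr u v w : ip u (v + w) = ip u v + ip u w.
Proof. by rewrite dotC dotDl !(dotC ip u). Qed.

Lemma dotZr a u v : ip u (a *: v) = a * ip u v.
Proof. by rewrite dotC dotZl dotC. Qed.

Lemma dotNl u v : ip (- u) v = - ip u v.
Proof. by rewrite -scaleN1r dotZl mulN1r. Qed.

Lemma dotNr u v : ip u (- v) = - ip u v.
Proof. by rewrite dotC dotNl dotC. Qed.

Lemma dot0l v : ip 0 v = 0.
Proof. by rewrite -(scale0r v) dotZl mul0r. Qed.

Lemma dot0r v : ip v 0 = 0.
Proof. by rewrite dotC dot0l. Qed.

Definition dotE := (dotDl, dotDr, dotNl, dotNr, dotZl, dotZr, dot0l, dot0r).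

Lemma dot_suml (I : Type) (r : seq I) (F : I -> V) v :
  ip (\sum_(i <- r) F i) v = \sum_(i <- r) ip (F i) v.
Proof.
by elim: r => [|i r IHr]; rewrite ?big_nil ?dot0l// !big_cons dotDl IHr.
Qed.

Lemma dot_sumr (I : Type) (r : seq I) (F : I -> V) v :
  ip v (\sum_(i <- r) F i) = \sum_(i <- r) ip v (F i).
Proof. by rewrite dotC dot_suml; apply: eq_bigr => i _; rewrite dotC. Qed.

Definition sqn u := ip u u.

Lemma sqn_sum (I : Type) (r : seq I) (F : I -> V) :
  sqn (\sum_(i <- r) F i) = \sum_(i <- r) \sum_(j <- r) ip (F i) (F j).
Proof. by rewrite /sqn dot_suml; apply: eq_bigr => i _; rewrite dot_sumr. Qed.

Lemma sqn_ge0 u : 0 <= sqn u. Proof. exact: dot_ge0. Qed.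

Lemma sqnZ a u : sqn (a *: u) = a ^+ 2 * sqn u.
Proof. by rewrite /sqn !dotE mulrA. Qed.

Lemma sqnN u : sqn (- u) = sqn u.
Proof. by rewrite /sqn !dotE opprK. Qed.

Lemma sqnB u v : sqn (u - v) = sqn (v - u).
Proof. by rewrite -sqnN opprB. Qed.

Lemma sqnD u v : sqn (u + v) = sqn u + 2 * ip u v + sqn v.
Proof. by rewrite /sqn !dotE (dotC ip v u); ring. Qed.

Lemma sqnD_le u v : sqn (u + v) <= 2 * sqn u + 2 * sqn v.
Proof. by have := sqn_ge0 (u - v); rewrite !sqnD sqnN dotNr; lra. Qed.

Lemma sqn_triangle v u w : sqn (u - w) <= 2 * sqn (u - v) + 2 * sqn (v - w).
Proof. by have := sqnD_le (u - v) (v - w); rewrite addrA subrK. Qed.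

Lemma discr_le0 a b c : (forall t : R, 0 <= a + 2 * b * t + c * t ^+ 2) ->
  b ^+ 2 <= a * c.
Proof.
move=> q_ge0; have a0 : 0 <= a by have := q_ge0 0; lra.
have [c0|c0|c0] := ltrgtP c 0.
- have [b0 b1] : b ^+ 2 >= 0 /\ b ^+ 2 >= 0 by split; exact: sqr_ge0.
  (* With k = 1 + a + 2|b| this [t] satisfies [t >= k] and [c * t <= - k], so the quadratic is at
     most a - (1 + a) t, which is negative. *)
  have := q_ge0 ((1 + a + 2 * `|b|) * (1 - c^-1)).
  have ci : c * c^-1 = 1 by rewrite divff// lt_eqF.
  have ci0 : c^-1 < 0 by rewrite invr_lt0.
  have nb : b <= `|b| by exact: ler_norm.
  have := normr_ge0 b; move: (`|b|) (c^-1) ci ci0 nb => B d ci d0 bB B0.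
  set k := 1 + a + 2 * B; set t := k * _.
  have k1 : 1 <= k by rewrite /k; lra.
  have t1 : k <= t by rewrite /t; nra.
  have ct : c * t <= - k by rewrite /t; nra.
  have : 2 * b * t <= 2 * B * t by nra.
  have : c * t ^+ 2 <= - k * t by rewrite expr2; nra.
  have : a <= a * t by nra.
  rewrite /k; nra.
- have := q_ge0 (- (b / c)).
  have -> : a + 2 * b * - (b / c) + c * (- (b / c)) ^+ 2 = (a * c - b ^+ 2) / c.
    by field; rewrite gt_eqF.
  by rewrite pmulr_lge0 ?invr_gt0// subr_ge0.
- rewrite c0 mulr0; have [->|b0] := eqVneq b 0; first by rewrite expr0n.
  have := q_ge0 (- ((a + 1) / (2 * b))).
  have -> : a + 2 * b * - ((a + 1) / (2 * b)) + c * (- ((a + 1) / (2 * b))) ^+ 2 = -1.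
    by rewrite c0; field.
  lra.
Qed.

Lemma dot_CauchySchwarz u v : ip u v ^+ 2 <= sqn u * sqn v.
Proof.
apply: discr_le0 => t; have := sqn_ge0 (u + t *: v).
by rewrite sqnD sqnZ dotZr; lra.
Qed.

Lemma dot_sqn0l u v : sqn u = 0 -> ip u v = 0.
Proof.
move=> u0; have := dot_CauchySchwarz u v; rewrite u0 mul0r.
by rewrite exprn_even_le0 //= => /eqP.
Qed.

Lemma dot_sqn0r u v : sqn v = 0 -> ip u v = 0.
Proof. by move=> v0; rewrite dotC dot_sqn0l. Qed.

Lemma sqnD0 u v : sqn v = 0 -> sqn (u + v) = sqn u.
Proof. by move=> v0; rewrite sqnD v0 dot_sqn0r//; ring. Qed.

Lemma eq0_sqr_le a : (forall e, 0 < e -> a ^+ 2 <= e) -> a = 0.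
Proof.
move=> ae; apply/eqP; rewrite -sqrf_eq0 eq_le sqr_ge0 andbT.
by apply/ler_addgt0Pl => e /ae; rewrite addr0.
Qed.

Lemma eq0_ge0_le a b : 0 <= a -> (forall e, 0 < e -> a <= e * b) -> a = 0.
Proof.
move=> a0 ae; apply/eqP; rewrite eq_le a0 andbT leNgt; apply/negP => agt0.
have b0 : 0 < b by have := ae 1 ltr01; lra.
have := ae (a / (2 * b)); rewrite divr_gt0 ?mulr_gt0// => /(_ isT).
have -> : a / (2 * b) * b = a / 2 by field; rewrite gt_eqF.
lra.
Qed.

Definition cauchy_sqn (u : nat -> V) := forall e, 0 < e ->
  exists n0, forall m n, (n0 <= m)%N -> (n0 <= n)%N -> sqn (u m - u n) <= e.

Definition cvg_sqn (u : nat -> V) v := forall e, 0 < e ->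
  exists n0, forall n, (n0 <= n)%N -> sqn (u n - v) <= e.

Definition complete_sqn := forall u : nat -> V, cauchy_sqn u -> exists v, cvg_sqn u v.

Definition subspace (M : set V) := M 0 /\ forall a u v, M u -> M v -> M (a *: u + v).

Definition closed_sqn (M : set V) := forall v,
  (forall e, 0 < e -> exists2 w, M w & sqn (v - w) <= e) -> M v.

Lemma subspaceD M u v : subspace M -> M u -> M v -> M (u + v).
Proof. by move=> [_ +] Mu Mv => /(_ 1 u v Mu Mv); rewrite scale1r. Qed.

Lemma subspaceZ M a u : subspace M -> M u -> M (a *: u).
Proof. by move=> [M0 +] Mu => /(_ a u 0 Mu M0); rewrite addr0. Qed.

Lemma subspaceB M u v : subspace M -> M u -> M v -> M (u - v).
Proof.
by move=> sM Mu Mv; rewrite -scaleN1r; apply: subspaceD => //; exact: subspaceZ.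
Qed.

Lemma cvg_closed M (u : nat -> V) v : closed_sqn M -> (forall n, M (u n)) ->
  cvg_sqn u v -> M v.
Proof.
move=> clM Mu uv; apply: clM => e e0; have [n0 n0P] := uv e e0.
by exists (u n0) => //; rewrite sqnB; exact: n0P.
Qed.

Lemma harmonic_small e : 0 < e -> exists n0, forall n, (n0 <= n)%N -> n.+1%:R^-1 <= e :> R.
Proof.
move=> e0; exists (Num.truncn e^-1) => n ne; rewrite invf_ple ?posrE//.
have /andP[_ /ltW le1] := Num.Theory.truncn_itv (ltW (etrans (invr_gt0 e) e0)).
by apply: le_trans le1 _; rewrite ler_nat.
Qed.

End SemiInnerProductTheory.

(** * Orthogonal projection onto a closed subspace *)

Section Projection.
Context (R : realType) (V : lmodType R) (ip : semi_inner_product V).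
Local Notation N := (sqn ip).

Lemma parallelogram_mid f u v :
  N (u - v) = 2 * N (f - u) + 2 * N (f - v) - 4 * N (f - 2^-1 *: (u + v)).
Proof.
rewrite /sqn !dotE (dotC ip u v) (dotC ip u f) (dotC ip v f).
by field.
Qed.

(** The parallelogram identity makes a minimising sequence Cauchy. Orthogonality is read off the
    approximants [m n]: minimality up to 1/(n+1) bounds <f - m n, w>^2 by N(w)/(n+1) through the
    discriminant, and Cauchy-Schwarz controls the error m n - p. *)
Lemma orthogonal_projection (M : set V) (f : V) : complete_sqn ip ->
  subspace M -> closed_sqn ip M ->
  exists2 p, M p & forall m, M m -> ip (f - p) m = 0.
Proof.
move=> Vc sM clM; pose E := [set N (f - m) | m in M].
have E0 : E !=set0 by exists (N (f - 0)); exists 0 => //; case: sM.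
have lbE : lbound E 0 by move=> _ [m _ <-]; exact: sqn_ge0.
have infE : has_inf E by split=> //; exists 0.
have dle m : M m -> inf E <= N (f - m).
  by move=> Mm; apply: ge_inf; [exists 0|exists m].
have /choice[m mP] : forall n, exists m, M m /\ N (f - m) < inf E + n.+1%:R^-1.
  move=> n; have [||_ [m Mm <-] ltm] := @inf_adherent _ E n.+1%:R^-1 => //.
  by exists m.
have Mm n := (mP n).1.
have [e e0|p mp] := Vc m.
  have /harmonic_small[n0 n0P] : 0 < e / 4 by lra.
  exists n0 => i j ni nj; rewrite (parallelogram_mid f).
  have := dle (2^-1 *: (m i + m j)) (subspaceZ _ sM (subspaceD sM (Mm i) (Mm j))).
  have := n0P _ ni; have := n0P _ nj; have := (mP i).2; have := (mP j).2.
  by move: (i.+1%:R^-1) (j.+1%:R^-1) => *; lra.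
have Mp : M p := cvg_closed clM Mm mp.
exists p => // w Mw; apply: eq0_sqr_le => e e0.
have W0 := sqn_ge0 ip w.
(* Both inner products below have square at most c N(w), and (x + y)^2 <= 2 x^2 + 2 y^2 <= 4 c N(w)
   <= e. *)
pose c := e / (4 * (N w + 1)).
have c0 : 0 < c by rewrite divr_gt0// mulr_gt0//; lra.
have [n1 n1P] := harmonic_small c0.
have [n2 n2P] := mp c c0.
pose n := maxn n1 n2.
have /discr_le0 h1 t : 0 <= n.+1%:R^-1 + 2 * ip (f - m n) w * t + N w * t ^+ 2.
  have Mt : M (m n - t *: w) by apply: subspaceB => //; exact: subspaceZ.
  have := dle _ Mt; have := (mP n).2.
  have -> : f - (m n - t *: w) = (f - m n) + t *: w by rewrite opprB addrCA addrC.
  by rewrite (sqnD _ (f - m n)) sqnZ dotZr; move: (n.+1%:R^-1) => *; lra.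
have h2 := dot_CauchySchwarz ip (m n - p) w.
have h3 := n1P n (leq_maxl _ _); have h4 := n2P n (leq_maxr _ _).
have h5 : n.+1%:R^-1 * N w <= c * N w by exact: ler_wpM2r.
have h6 : N (m n - p) * N w <= c * N w by exact: ler_wpM2r.
have -> : f - p = (f - m n) + (m n - p) by rewrite addrA subrK.
rewrite dotDl.
have : 4 * (c * N w) <= e.
  have -> : e = 4 * (c * (N w + 1)) by rewrite /c; field; apply/negP => /eqP; lra.
  nra.
have := le_trans h1 h5; have := le_trans h2 h6.
move: (ip (f - m n) w) (ip (m n - p) w) (c * N w) => x y z {h1 h2 h5 h6} *.
by have := sqr_ge0 (x - y); nra.
Qed.

End Projection.

(** * Sums of rank one operators *)

Section WeightedRankOne.
Context (R : realType) (V : lmodType R) (ip : semi_inner_product V).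
Local Notation N := (sqn ip).
Implicit Types (L : seq (R * V)) (u v : V).

(* A weighted list of vectors stands for the operator \sum w v (x) v; [hs] is the
   Hilbert-Schmidt inner product, computed from <v (x) v, v' (x) v'> = <v, v'>^2. *)
Definition wop L u := \sum_(x <- L) (x.1 * ip u x.2) *: x.2.

Definition hs L L' : R :=
  \sum_(x <- L) \sum_(y <- L') x.1 * y.1 * ip x.2 y.2 ^+ 2.

Definition wscale (a : R) L := [seq (a * x.1, x.2) | x <- L].

Lemma hs_catl L1 L2 L : hs (L1 ++ L2) L = hs L1 L + hs L2 L.
Proof. by rewrite /hs big_cat. Qed.

Lemma hs_catr L1 L2 L : hs L (L1 ++ L2) = hs L L1 + hs L L2.
Proof. by rewrite /hs -big_split; apply: eq_bigr => x _; rewrite big_cat. Qed.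

Lemma hsC L L' : hs L L' = hs L' L.
Proof.
rewrite /hs exchange_big; apply: eq_bigr => x _; apply: eq_bigr => y _.
by rewrite (mulrC x.1) (dotC ip x.2).
Qed.

Lemma hs_scalel a L L' : hs (wscale a L) L' = a * hs L L'.
Proof.
rewrite /hs big_map mulr_sumr; apply: eq_bigr => x _; rewrite mulr_sumr.
by apply: eq_bigr => y _; rewrite !mulrA.
Qed.

Lemma hs_scaler a L L' : hs L (wscale a L') = a * hs L L'.
Proof. by rewrite hsC hs_scalel hsC. Qed.

Lemma wop_cat L1 L2 u : wop (L1 ++ L2) u = wop L1 u + wop L2 u.
Proof. by rewrite /wop big_cat. Qed.

Lemma wop_scale a L u : wop (wscale a L) u = a *: wop L u.
Proof.
by rewrite /wop big_map scaler_sumr; apply: eq_bigr => x _; rewrite scalerA mulrA.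
Qed.

Lemma wopZ a L u : wop L (a *: u) = a *: wop L u.
Proof.
rewrite /wop scaler_sumr; apply: eq_bigr => x _.
by rewrite scalerA dotZl mulrCA.
Qed.

Lemma dot_wop L u v : ip (wop L u) v = \sum_(x <- L) x.1 * ip u x.2 * ip x.2 v.
Proof. by rewrite dot_suml; apply: eq_bigr => x _; rewrite dotZl. Qed.

Lemma wop_sym L u v : ip (wop L u) v = ip u (wop L v).
Proof.
rewrite (dotC ip u) !dot_wop; apply: eq_bigr => x _.
by rewrite (dotC ip v) (dotC ip u) -!mulrA (mulrC (ip _ _)).
Qed.

(** For a unit vector e and P = 1 - e (x) e, this list represents P A P when [L] represents A. The
    splitting below is the block decomposition of A along e: N(A e) and N(P A e) account for the
    corner and the two equal off-diagonal blocks. *)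
Definition wproj (e : V) L := [seq (x.1, x.2 - ip x.2 e *: e) | x <- L].

(* Termwise, with p = <v, v'> and q = <v, e> <v', e>:
   p^2 = q p + q (p - q) + (p - q)^2. *)
Lemma hs_split (e : V) L : N e = 1 ->
  hs L L = N (wop L e)
    + N (\sum_(x <- L) (x.1 * ip x.2 e) *: (x.2 - ip x.2 e *: e))
    + hs (wproj e L) (wproj e L).
Proof.
move=> e1; rewrite /wop !sqn_sum /hs big_map -!big_split; apply: eq_bigr => x _ /=.
rewrite big_map -!big_split; apply: eq_bigr => y _ /=.
rewrite !dotE (dotC ip e x.2) (dotC ip e y.2).
have -> : ip e e = 1 by [].
by ring.
Qed.

Lemma hs_cons0 x L : N x.2 = 0 -> hs (x :: L) (x :: L) = hs L L.
Proof.
move=> x0; have hs1 L' : hs [:: x] L' = 0.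
  by rewrite /hs big_seq1 big1// => y _; rewrite dot_sqn0l// expr0n mulr0.
by rewrite -cat1s hs_catl hs1 hs_catr hsC hs1 !add0r.
Qed.

Lemma sqn_normalize u : N u != 0 -> N ((Num.sqrt (N u))^-1 *: u) = 1.
Proof.
by move=> u0; rewrite sqnZ exprVn sqr_sqrtr ?sqn_ge0// mulVf.
Qed.

(** Induction on the length, the weights having arbitrary sign: splitting along the direction of the
    first vector annihilates that vector in [wproj], and a null head does not count. *)
Lemma hs_ge0 L : 0 <= hs L L.
Proof.
have [n] := ubnP (size L); elim: n L => // n IHn [|[a v] L] /=.
  by rewrite /hs big_nil.
rewrite ltnS => sL; have [v0|v0] := eqVneq (N v) 0.
  by rewrite hs_cons0//; exact: IHn.
set e := (Num.sqrt (N v))^-1 *: v.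
have e1 : N e = 1 := sqn_normalize v0.
rewrite (hs_split _ e1) !addr_ge0 ?sqn_ge0//.
rewrite /wproj /= hs_cons0 /=; first by apply: IHn; rewrite size_map.
have s2 : (Num.sqrt (N v)) ^+ 2 = N v by rewrite sqr_sqrtr ?sqn_ge0.
have s0 : Num.sqrt (N v) != 0 by rewrite -sqrf_eq0 s2.
have -> : ip v e *: e = v; last by rewrite subrr /sqn dot0l.
rewrite /e dotZr scalerA -[ip v v]/(N v).
move: (Num.sqrt (N v)) s2 s0 => s <- s0.
have -> : s^-1 * s ^+ 2 / s = 1 by field.
by rewrite scale1r.
Qed.

(** The operator norm is at most the Hilbert-Schmidt norm: N(A e) is one of the three nonnegative
    terms of [hs_split] for e = u / |u|. *)
Lemma wop_le_hs L u : N (wop L u) <= hs L L * N u.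
Proof.
have [u0|u0] := eqVneq (N u) 0.
  rewrite u0 mulr0 /wop big1 /sqn ?dot0l// => x _.
  by rewrite dot_sqn0l// mulr0 scale0r.
have e1 := sqn_normalize u0; set e := _ *: u in e1.
have uE : u = Num.sqrt (N u) *: e.
  by rewrite /e scalerA mulfV ?scale1r// -sqrf_eq0 sqr_sqrtr ?sqn_ge0.
rewrite {1}uE wopZ sqnZ sqr_sqrtr ?sqn_ge0// mulrC ler_wpM2r ?sqn_ge0//.
by rewrite (hs_split _ e1) -addrA lerDl addr_ge0 ?sqn_ge0 ?hs_ge0.
Qed.

End WeightedRankOne.

(** * Almost periodic and flight vectors *)

Section TotallyBounded.
Context (R : realType) (V : lmodType R) (ip : semi_inner_product V).
Local Notation N := (sqn ip).
Implicit Types (A B : set V) (u v : V).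

Definition tot_bounded A := forall e : R, 0 < e ->
  exists s : seq V, forall u, A u -> exists2 v, v \in s & N (u - v) <= e.

(** B need only be the image of A up to null vectors, which is all that limit operators such as H
    provide. *)
Lemma tot_bounded_lipschitz A B (c : R) (F : V -> V) : 0 < c ->
  (forall u v, N (F u - F v) <= c * N (u - v)) ->
  (forall w, B w -> exists2 u, A u & N (w - F u) = 0) ->
  tot_bounded A -> tot_bounded B.
Proof.
move=> c0 Fc BA tA e e0.
have ec0 : 0 < e / (2 * c) by rewrite divr_gt0// mulr_gt0.
have [s sP] := tA _ ec0.
exists (map F s) => w /BA[u Au wu]; have [v vs uv] := sP u Au.
exists (F v); first exact: map_f.
apply: le_trans (sqn_triangle ip (F u) w (F v)) _; rewrite wu mulr0 add0r.
have -> : e = 2 * (c * (e / (2 * c))) by field; rewrite gt_eqF.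
rewrite ler_pM2l//; apply: le_trans (Fc _ _) _.
by rewrite ler_pM2l.
Qed.

Lemma tot_boundedD A B C : (forall w, C w -> exists u v, [/\ A u, B v & w = u + v]) ->
  tot_bounded A -> tot_bounded B -> tot_bounded C.
Proof.
move=> CAB tA tB e e0; have e4 : 0 < e / 4 by lra.
have [s sP] := tA _ e4; have [t tP] := tB _ e4.
exists [seq u + v | u <- s, v <- t] => w /CAB[u [v [Au Bv ->]]].
have [u' us uu] := sP u Au; have [v' vt vv] := tP v Bv.
exists (u' + v'); first by apply/allpairsP; exists (u', v').
have -> : u + v - (u' + v') = (u - u') + (v - v') by rewrite opprD addrACA.
by have := sqnD_le ip (u - u') (v - v'); lra.
Qed.

Lemma tot_bounded_approx A :
  (forall e : R, 0 < e -> exists2 B, tot_bounded B &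
    forall u, A u -> exists2 v, B v & N (u - v) <= e) -> tot_bounded A.
Proof.
move=> AB e e0; have e4 : 0 < e / 4 by lra.
have [B tB {}AB] := AB _ e4; have [s sP] := tB _ e4.
exists s => u /AB[v Bv uv]; have [w ws vw] := sP v Bv; exists w => //.
by have := sqn_triangle ip v u w; lra.
Qed.

Lemma real_net (B e : R) : 0 < e -> exists s : seq R,
  forall c, `|c| <= B -> exists2 b, b \in s & (c - b) ^+ 2 <= e.
Proof.
(* A mesh of at most 1 gives d^2 <= d <= e. *)
move=> e0; pose d := Num.min 1 e.
have d0 : 0 < d by rewrite lt_min ltr01.
have d1 : d <= 1 by rewrite ge_min lexx.
have de : d <= e by rewrite ge_min lexx orbT.
exists [seq - B + i%:R * d | i <- iota 0 (Num.truncn (2 * B / d)).+1] => c.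
rewrite ler_norml => /andP[cB1 cB2]; pose i := Num.truncn ((c + B) / d).
have x0 : 0 <= (c + B) / d by rewrite divr_ge0 ?(ltW d0)//; lra.
have /andP[ile ilt] := truncn_itv x0.
rewrite -/i ler_pdivlMr// in ile; rewrite -/i ltr_pdivrMr// -addn1 natrD mulrDl mul1r in ilt.
exists (- B + i%:R * d).
  apply/mapP; exists i => //; rewrite mem_iota/= add0n ltnS; apply: le_truncn.
  by rewrite ler_pM2r ?invr_gt0//; lra.
move: (i%:R * d) ile ilt => y *; nra.
Qed.

Lemma tot_bounded_line v (B : R) : tot_bounded [set c *: v | c in [set c | `|c| <= B]].
Proof.
move=> e e0; have N0 := sqn_ge0 ip v.
have [|s sP] := @real_net B (e / (N v + 1)); first by rewrite divr_gt0//; lra.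
exists [seq b *: v | b <- s] => _ [c cB <-]; have [b bs bc] := sP c cB.
exists (b *: v); first by apply/mapP; exists b.
rewrite -scalerBl sqnZ; move: bc; rewrite ler_pdivlMr; last lra.
by apply: le_trans; rewrite ler_wpM2l ?sqr_ge0//; lra.
Qed.

Lemma tot_bounded_wop (L : seq (R * V)) (r : R) :
  tot_bounded [set wop ip L u | u in [set u | N u <= r]].
Proof.
elim: L => [|[a v] L IHL].
  move=> e e0; exists [:: 0] => _ [u _ <-]; exists 0; rewrite ?mem_head//.
  by rewrite /wop big_nil subrr /sqn dot0l ltW.
(* The radius comes from |<u, v>| <= 1 + <u, v>^2 <= 1 + r N(v). *)
apply: tot_boundedD (tot_bounded_line v (`|a| * (1 + r * N v))) IHL.
move=> _ [u ur <-]; rewrite /wop big_cons /=.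
exists ((a * ip u v) *: v), (wop ip L u); split=> //; last by exists u.
exists (a * ip u v) => //=; rewrite normrM ler_wpM2l//.
have := dot_CauchySchwarz ip u v; rewrite -real_normK ?num_real//.
have := sqn_ge0 ip v; have := normr_ge0 (ip u v).
move: ur => /=; move: (N u) (N v) `|_| => x y z xr z0 y0 zxy.
have xry : x * y <= r * y by exact: ler_wpM2r.
by have := sqr_ge0 (z - 1); nra.
Qed.

End TotallyBounded.

(** * Isometric actions of the integers *)

Record isometric_Zaction (R : realType) (V : lmodType R)
    (ip : semi_inner_product V) := IsometricZaction {
  act :> int -> V -> V ;
  actD : forall n u v, act n (u + v) = act n u + act n v ;
  actZ : forall n a u, act n (a *: u) = a *: act n u ;
  actM : forall m n u, act m (act n u) = act (m + n) u ;
  act0 : forall u, act 0 u = u ;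
  act_dot : forall n u v, ip (act n u) (act n v) = ip u v }.

Section ZactionTheory.
Context (R : realType) (V : lmodType R) (ip : semi_inner_product V).
Context (U : isometric_Zaction ip).
Local Notation N := (sqn ip).
Implicit Types (u v f : V) (L : seq (R * V)) (n : int).

Lemma actN n u : U n (- u) = - U n u.
Proof. by rewrite -(scaleN1r u) actZ scaleN1r. Qed.

Lemma actB n u v : U n (u - v) = U n u - U n v.
Proof. by rewrite actD actN. Qed.

Lemma act_zero n : U n 0 = 0.
Proof. by have := actZ U n 0 0; rewrite !scale0r. Qed.

Lemma act_sqn n u : N (U n u) = N u.
Proof. exact: act_dot. Qed.

Lemma act_sum n (I : Type) (r : seq I) (F : I -> V) :
  U n (\sum_(i <- r) F i) = \sum_(i <- r) U n (F i).
Proof.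
elim: r => [|i r IHr]; first by rewrite !big_nil act_zero.
by rewrite !big_cons actD IHr.
Qed.

Definition almost_periodic f := tot_bounded ip [set U n f | n in setT].

Definition flight f := forall (s : seq V) (e : R), 0 < e ->
  exists n, forall v, v \in s -> `|ip f (U n v)| <= e.

Lemma almost_periodic_subspace : subspace almost_periodic.
Proof.
split=> [e e0|a u v apu apv].
  exists [:: 0] => _ [n _ <-]; exists 0; rewrite ?mem_head//.
  by rewrite act_zero subrr /sqn dot0l ltW.
have ap : tot_bounded ip [set U n (a *: u) | n in setT].
  apply: (@tot_bounded_lipschitz _ _ _ _ _ (a ^+ 2 + 1) ( *:%R a)) apu.
  - by have := sqr_ge0 a; lra.
  - move=> x y; rewrite -scalerBr sqnZ ler_wpM2r ?sqn_ge0//; lra.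
  - move=> _ [n _ <-]; exists (U n u); first by exists n.
    by rewrite actZ subrr /sqn dot0l.
apply: tot_boundedD ap apv => _ [n _ <-].
by exists (U n (a *: u)), (U n v); split; [exists n|exists n|rewrite actD].
Qed.

Lemma almost_periodic_closed : closed_sqn ip almost_periodic.
Proof.
move=> v vM; apply: tot_bounded_approx => e e0.
have [w apw vw] := vM e e0; exists [set U n w | n in setT] => // _ [n _ <-].
by exists (U n w); [exists n|rewrite -actB act_sqn].
Qed.

(** If v is a net point near U^-n f, then <U^-n f, v> = <f, U^n v> is small by flight. Expanding
    N(U^-n f - v) <= e gives N(f) <= e + 2e, whence the constant 3. *)
Lemma almost_periodic_flight_null f : almost_periodic f -> flight f -> N f = 0.
Proof.
move=> apf flf; apply: (@eq0_ge0_le _ _ 3) => [|e e0]; first exact: sqn_ge0.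
have [s sP] := apf _ e0; have [n nP] := flf s e e0.
have [|v vs] := sP (U (- n) f); first by exists (- n).
have := nP v vs; rewrite ler_norml => /andP[_].
rewrite -(act_dot U (- n)) actM addNr act0 sqnD act_sqn sqnN dotNr.
by have := sqn_ge0 ip v => *; lra.
Qed.

End ZactionTheory.

(** * An invariant compact operator from a minimal norm argument *)

Section InvariantCompactOperator.
Context (R : realType) (V : lmodType R) (ip : semi_inner_product V).
Context (U : isometric_Zaction ip).
Local Notation N := (sqn ip).
Implicit Types (u v f : V) (L : seq (R * V)) (n : int) (s : seq V).

Definition orbit_gen s n : seq (R * V) := [seq (1, U n g) | g <- s].

Definition wact n L := [seq (x.1, U n x.2) | x <- L].

(** Midpoints suffice as convexity, since the parallelogram law involves nothing else. The
    generators are the conjugates by U^n of \sum_g g (x) g. *)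
Inductive dyadic_hull s : seq (R * V) -> Prop :=
| dyadic_hull_gen n : dyadic_hull s (orbit_gen s n)
| dyadic_hull_mid L1 L2 : dyadic_hull s L1 -> dyadic_hull s L2 ->
    dyadic_hull s (wscale 2^-1 (L1 ++ L2)).

Lemma dyadic_hull_act s n L : dyadic_hull s L -> dyadic_hull s (wact n L).
Proof.
elim=> [m|L1 L2 _ h1 _ h2].
  suff -> : wact n (orbit_gen s m) = orbit_gen s (n + m) by exact: dyadic_hull_gen.
  by rewrite /wact /orbit_gen -map_comp; apply: eq_map => g /=; rewrite actM.
suff -> : wact n (wscale 2^-1 (L1 ++ L2)) = wscale 2^-1 (wact n L1 ++ wact n L2).
  exact: dyadic_hull_mid.
by rewrite /wact /wscale -map_cat -!map_comp.
Qed.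

Lemma hs_act n L : hs ip (wact n L) (wact n L) = hs ip L L.
Proof.
rewrite /hs big_map; apply: eq_bigr => x _; rewrite big_map.
by apply: eq_bigr => y _ /=; rewrite act_dot.
Qed.

Lemma wop_act n L u : U n (wop ip L u) = wop ip (wact n L) (U n u).
Proof.
rewrite /wop act_sum big_map; apply: eq_bigr => x _ /=.
by rewrite actZ act_dot.
Qed.

(** <A f, f> is affine in A, so a lower bound on the generators holds on the whole hull. Passed to
    the limit, it keeps H nonzero at f. *)
Lemma dyadic_hull_dot s f (e : R) L :
  (forall n, e <= \sum_(g <- s) ip f (U n g) ^+ 2) ->
  dyadic_hull s L -> e <= ip (wop ip L f) f.
Proof.
move=> fe; elim=> [n|L1 L2 _ h1 _ h2]; last first.
  by rewrite wop_scale wop_cat dotZl dotDl; lra.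
rewrite dot_wop big_map; apply: le_trans (fe n) _; rewrite le_eqVlt; apply/orP; left.
by apply/eqP/eq_bigr => g _ /=; rewrite (dotC ip (U n g)) mul1r expr2.
Qed.

(** Parallelogram law for [hs]: the difference has square norm at most 2(m + d) + 2(m + d) - 4m =
    4d, which dominates the operator norm. *)
Lemma hs_diff L1 L2 (m d : R) :
  m <= hs ip (wscale 2^-1 (L1 ++ L2)) (wscale 2^-1 (L1 ++ L2)) ->
  hs ip L1 L1 <= m + d -> hs ip L2 L2 <= m + d ->
  forall u, N (wop ip L1 u - wop ip L2 u) <= 4 * d * N u.
Proof.
move=> mL L1d L2d u.
have -> : wop ip L1 u - wop ip L2 u = wop ip (L1 ++ wscale (-1) L2) u.
  by rewrite wop_cat wop_scale scaleN1r.
apply: le_trans (wop_le_hs _ _ _) _; rewrite ler_wpM2r ?sqn_ge0//.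
move: mL; rewrite hs_scalel hs_scaler !(hs_catl, hs_catr, hs_scalel, hs_scaler).
by rewrite (hsC _ L2 L1) => *; lra.
Qed.

(* The point of minimal Hilbert-Schmidt norm in the closed convex hull of the orbit
   of \sum_g g (x) g is invariant: this is the mean ergodic theorem for the conjugation
   action, proved by Riesz' argument. *)
Lemma hull_limit s : complete_sqn ip ->
  exists (H : V -> V) (P : R -> set (seq (R * V))),
  [/\ forall d, 0 < d -> exists L, P d L,
      forall d L, P d L -> dyadic_hull s L,
      forall d L n, P d L -> P d (wact n L) &
      forall d L u, 0 < d -> P d L -> N (H u - wop ip L u) <= d * N u].
Proof.
move=> Vc; pose E := [set hs ip L L | L in dyadic_hull s].
have E0 : E !=set0.
  by exists (hs ip (orbit_gen s 0) (orbit_gen s 0)); exists (orbit_gen s 0) => //; left.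
have lbE : lbound E 0 by move=> _ [L _ <-]; exact: hs_ge0.
have infE : has_inf E by split=> //; exists 0.
have mle L : dyadic_hull s L -> inf E <= hs ip L L.
  by move=> hL; apply: ge_inf; [exists 0|exists L].
have diff L1 L2 d u : dyadic_hull s L1 -> dyadic_hull s L2 ->
    hs ip L1 L1 <= inf E + d -> hs ip L2 L2 <= inf E + d ->
    N (wop ip L1 u - wop ip L2 u) <= 4 * d * N u.
  by move=> h1 h2 h3 h4; apply: hs_diff h3 h4 _; apply/mle/dyadic_hull_mid.
have near_inf d : 0 < d -> exists L, dyadic_hull s L /\ hs ip L L <= inf E + d.
  by move=> d0; have [_ [L hL <-] /ltW ltL] := inf_adherent d0 infE; exists L.
have /choice[K KP] : forall k : nat, exists L, dyadic_hull s L /\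
    hs ip L L <= inf E + k.+1%:R^-1.
  by move=> k; exact: near_inf.
have Kd d k : k.+1%:R^-1 <= d -> hs ip (K k) (K k) <= inf E + d.
  by move=> kd; apply: le_trans (KP k).2 _; rewrite lerD2l.
have /choice[H HP] : forall u, exists v, cvg_sqn ip (fun k => wop ip (K k) u) v.
  move=> u; apply: Vc => e e0; have N0 := sqn_ge0 ip u.
  have ce : 0 < e / (4 * (N u + 1)) by rewrite divr_gt0// mulr_gt0//; lra.
  have [n0 n0P] := harmonic_small ce; exists n0 => i j ni nj.
  apply: le_trans (diff _ _ _ u (KP i).1 (KP j).1 (Kd _ _ (n0P _ ni)) (Kd _ _ (n0P _ nj))) _.
  have -> : 4 * (e / (4 * (N u + 1))) * N u = e * (N u / (N u + 1)).
    by field; rewrite gt_eqF//; lra.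
  by rewrite ler_piMr ?ltW// ltr_pdivrMr; lra.
(* [P d] consists of near minimisers, a set stable under conjugation because [hs] is. The 8 absorbs
   the factor 4 of [hs_diff] and the factor 2 of the triangle inequality. *)
exists H, (fun d => [set L | dyadic_hull s L /\ hs ip L L <= inf E + d / 8]); split.
- by move=> d d0; apply: near_inf; lra.
- by move=> d L [].
- by move=> d L n [hL L8]; split; [exact: dyadic_hull_act|rewrite hs_act].
move=> d L u d0 [hL L8]; apply/ler_addgt0Pr => e e0.
have d8 : 0 < d / 8 by lra.
have [n1 n1P] := harmonic_small d8.
have [n2 n2P] := HP u (e / 2) ltac:(lra).
have := sqn_triangle ip (wop ip (K (maxn n1 n2)) u) (H u) (wop ip L u).
have := n2P _ (leq_maxr n1 n2); rewrite sqnB.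
have := diff _ _ _ u (KP (maxn n1 n2)).1 hL (Kd _ _ (n1P _ (leq_maxl n1 n2))) L8.
by move=> *; lra.
Qed.

(** Everything is inherited from the lists in [P d], which approximate H uniformly on balls. A list
    and its conjugate both lie in [P d], which yields commutation with U; a uniform limit of finite
    rank operators is compact. *)
Lemma invariant_compact_operator s : complete_sqn ip ->
  exists H : V -> V,
  [/\ forall u v, ip (H u) v = ip u (H v),
      forall n u, N (U n (H u) - H (U n u)) = 0,
      forall r : R, tot_bounded ip [set H u | u in [set u | N u <= r]],
      exists2 c : R, 0 <= c & forall u, N (H u) <= c * N u &
      forall f e, (forall n, e <= \sum_(g <- s) ip f (U n g) ^+ 2) -> e <= ip (H f) f].
Proof.
move=> /(hull_limit s)[H [P [Pex Phull Pact HP]]]; exists H; split.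
- move=> u v; apply/eqP; rewrite -subr_eq0; apply/eqP/eq0_sqr_le => e e0.
  have N0 : 0 <= N u * N v by rewrite mulr_ge0 ?sqn_ge0.
  have d0 : 0 < e / (4 * (N u * N v + 1)) by rewrite divr_gt0// mulr_gt0//; lra.
  set d := (e / _) in d0; have [L PL] := Pex d d0.
  have -> : ip (H u) v - ip u (H v) = ip (H u - wop ip L u) v - ip (H v - wop ip L v) u.
    by rewrite !dotE wop_sym (dotC ip (H v)) (dotC ip (wop _ _ v)); ring.
  have h1 := dot_CauchySchwarz ip (H u - wop ip L u) v.
  have h2 := dot_CauchySchwarz ip (H v - wop ip L v) u.
  have h3 : N (H u - wop ip L u) * N v <= d * N u * N v.
    by apply: ler_wpM2r; [exact: sqn_ge0|exact: HP].
  have h4 : N (H v - wop ip L v) * N u <= d * N v * N u.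
    by apply: ler_wpM2r; [exact: sqn_ge0|exact: HP].
  have h5 : 4 * (d * (N u * N v)) <= e.
    have -> : e = 4 * (d * (N u * N v + 1)) by rewrite /d; field; rewrite gt_eqF//; lra.
    by rewrite ler_pM2l// ler_pM2l//; lra.
  have := le_trans h1 h3; have := le_trans h2 h4; move: h5; rewrite mulrA.
  rewrite -(mulrA d (N v)) (mulrC (N v)) -[4 * d * _]mulrA -[d * N u * _]mulrA.
  move: (d * _) (ip (H u - _) v) (ip (H v - _) u) => z x y z4 yz xz.
  by have := sqr_ge0 (x + y); nra.
- move=> n u; apply: (@eq0_ge0_le _ _ (4 * N u)) => [|d d0]; first exact: sqn_ge0.
  have [L PL] := Pex d d0.
  have := sqn_triangle ip (U n (wop ip L u)) (U n (H u)) (H (U n u)).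
  rewrite -actB act_sqn [X in _ <= _ + 2 * X]sqnB wop_act.
  have := HP d L u d0 PL; have := HP d _ (U n u) d0 (Pact _ _ n PL).
  by rewrite act_sqn => *; lra.
- move=> r; apply: tot_bounded_approx => e e0.
  have d0 : 0 < e / (`|r| + 1) by rewrite divr_gt0// ltr_wpDl.
  have [L PL] := Pex _ d0.
  exists [set wop ip L u | u in [set u | N u <= r]]; first exact: tot_bounded_wop.
  move=> _ [u ur <-]; exists (wop ip L u); first by exists u.
  apply: le_trans (HP _ _ _ d0 PL) _; rewrite mulrAC ler_pdivrMr ?ltr_wpDl//.
  by rewrite ler_pM2l//; move: ur => /=; have := ler_norm r; lra.
- have [L PL] := Pex 1 ltr01.
  exists (2 + 2 * hs ip L L) => [|u]; first by have := hs_ge0 ip L; lra.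
  have := sqnD_le ip (H u - wop ip L u) (wop ip L u); rewrite subrK.
  by have := HP _ _ u ltr01 PL; have := wop_le_hs ip L u; lra.
- move=> f e fe; rewrite leNgt; apply/negP => lte.
  have g0 : 0 < e - ip (H f) f by rewrite subr_gt0.
  suff : e - ip (H f) f = 0 by lra.
  apply: eq0_sqr_le => d d0; have N0 := sqn_ge0 ip f.
  have N1 : 0 <= N f * N f by rewrite mulr_ge0.
  have d1 : 0 < d / (N f * N f + 1) by rewrite divr_gt0//; lra.
  have [L PL] := Pex _ d1; have := dyadic_hull_dot fe (Phull _ _ PL).
  have := dot_CauchySchwarz ip (H f - wop ip L f) f.
  have : N (H f - wop ip L f) * N f <= d / (N f * N f + 1) * N f * N f.
    by apply: ler_wpM2r => //; exact: HP.
  have : d / (N f * N f + 1) * N f * N f <= d.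
    by rewrite -[leLHS]mulrA mulrAC ler_pdivrMr ?ler_pM2l//; lra.
  rewrite dotDl dotNl => h1 h2 h3 h4.
  have {h1 h2 h3} := le_trans (le_trans h3 h2) h1.
  by move: (ip (H f) f) (ip (wop _ _ _) _) g0 h4 => x y *; nra.
Qed.

Lemma not_flightP f : ~ flight U f -> exists (s : seq V) (e : R),
  0 < e /\ forall n, e <= \sum_(g <- s) ip f (U n g) ^+ 2.
Proof.
move=> /existsNP[s /existsNP[e /not_implyP[e0 nfl]]].
exists s, (e ^+ 2); split=> [|n]; first exact: exprn_gt0.
have /forallNP/(_ n)/existsNP[v /not_implyP[vs /negP]] := nfl.
rewrite -ltNge => elt; rewrite (big_rem v)//= -[leLHS]addr0 lerD//.
  by rewrite -[leRHS]real_normK ?num_real// lerXn2r ?nnegrE ?normr_ge0 ?ltW.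
by apply: sumr_ge0 => g _; exact: sqr_ge0.
Qed.

(** H f is almost periodic because U^n H f agrees, up to a null vector, with H U^n f, which stays in
    the precompact image of a ball. *)
Lemma orthogonal_almost_periodic_flight f : complete_sqn ip ->
  (forall g, almost_periodic U g -> ip f g = 0) -> flight U f.
Proof.
move=> Vc fAP; apply: contrapT => /not_flightP[s [e [e0 fe]]].
have [H [_ HU Hc _ /(_ f e fe)]] := invariant_compact_operator s Vc.
rewrite dotC fAP; first lra.
move=> d d0; have [t tP] := Hc (N f) d d0; exists t => _ [n _ <-].
have [|v vt fv] := tP (H (U n f)); first by exists (U n f) => //=; rewrite act_sqn.
exists v => //; rewrite (_ : _ - v = H (U n f) - v + (U n (H f) - H (U n f))).
  by rewrite sqnD0.
by rewrite addrCA addrAC subrr add0r.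
Qed.

End InvariantCompactOperator.

(** * Eigenvectors *)

Section CompactSymmetric.
Context (R : realType) (V : lmodType R) (ip : semi_inner_product V).
Local Notation N := (sqn ip).
Implicit Types (u v w : V).

Lemma ultra_cover (G : set_system nat) (s : seq V) (P : V -> set nat) :
  UltraFilter G -> (forall n, exists2 v, v \in s & P v n) -> exists v, G (P v).
Proof.
move=> UG sP; apply: contrapT => /forallNP nG.
have GC : G [set n | forall v, v \in s -> ~ P v n].
  elim: s {sP} => [|v s IHs]; first by apply: filterS filterT => n _ v.
  have [//|Gv] := in_ultra_setVsetC (P v) UG; first by move/nG.
  apply: filterS (filterI Gv IHs) => n [nPv nPs] w.
  by rewrite inE => /predU1P[->//|]; exact: nPs.
have /filter_ex[n nP] := GC.
by have [v vs] := sP n; exact: nP.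
Qed.

(** Diagonal extraction along an ultrafilter: [w j] is a net point of scale 1/(j+1) that the
    ultrafilter selects, and [f j] is an index close to w 0, ..., w j at once. The bound [j <= f j]
    is all that later arguments on tails require, so [f] is not made increasing. *)
Lemma tot_bounded_subseq (A : set V) (x : nat -> V) :
  tot_bounded ip A -> (forall n, A (x n)) ->
  exists2 f : nat -> nat, (forall j, (j <= f j)%N) & cauchy_sqn ip (x \o f).
Proof.
move=> tA Ax; have [G [UG ooG]] := ultraFilterLemma eventually_filter.
have /choice[w wP] : forall j : nat, exists w, G [set n | N (x n - w) <= j.+1%:R^-1].
  move=> j; have [s sP] : exists s : seq V, forall u, A u ->
      exists2 v, v \in s & N (u - v) <= j.+1%:R^-1 by exact: tA.
  by apply: (@ultra_cover G s (fun v => [set n | N (x n - v) <= j.+1%:R^-1])) => n; exact: sP.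
have /choice[f fP] : forall j : nat, exists n, (j <= n)%N /\
    forall i, (i <= j)%N -> N (x n - w i) <= i.+1%:R^-1.
  move=> j.
  have Gj : G [set n | forall i, (i <= j)%N -> N (x n - w i) <= i.+1%:R^-1].
    elim: j => [|j IHj].
      by apply: filterS (wP 0%N) => n nP i; rewrite leqn0 => /eqP ->.
    apply: filterS (filterI (wP j.+1) IHj) => n [nP1 nP2] i.
    by rewrite leq_eqVlt => /predU1P[->//|]; exact: nP2.
  have Gn : G [set n | (j <= n)%N] by apply: ooG; exists j.
  by have [n [n1 n2]] := filter_ex (filterI Gn Gj); exists n.
exists f => [j|e e0]; first by have [] := fP j.
have e4 : 0 < e / 4 by lra.
have [n0 n0P] := harmonic_small e4; exists n0 => i j ni nj /=.
have := sqn_triangle ip (w n0) (x (f i)) (x (f j)).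
have := (fP i).2 _ ni; have := (fP j).2 _ nj; rewrite sqnB.
by have := n0P n0 (leqnn _); move: n0.+1%:R^-1 => *; lra.
Qed.

(** [C] is a bare function. Symmetry makes [C u - C v - C (u - v)] orthogonal to M, where it lies,
    so it is null and the norm bound becomes a Lipschitz bound. *)
Lemma symmetric_lipschitz (M : set V) (C : V -> V) (c : R) : subspace M ->
  (forall u, M u -> M (C u)) ->
  (forall u v, M u -> M v -> ip (C u) v = ip u (C v)) ->
  (forall u, M u -> N (C u) <= c * N u) ->
  forall u v, M u -> M v -> N (C u - C v) <= c * N (u - v).
Proof.
move=> sM MC Csym Cc u v Mu Mv; have MB := subspaceB sM Mu Mv; apply: le_trans (Cc _ MB).
have w0 : N (C u - C v - C (u - v)) = 0.
  have Mw : M (C u - C v - C (u - v)) by do !apply: subspaceB => //; exact: MC.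
  suff : forall y, M y -> ip (C u - C v - C (u - v)) y = 0 by apply.
  by move=> y My; rewrite !dotDl !dotNl !Csym// dotDl dotNl; ring.
by rewrite -[leRHS](sqnD0 (C (u - v)) w0) [X in _ <= N X]addrC subrK.
Qed.

(** The eigenvalue is the supremum [l] of <C u, u> over unit vectors of M. As the form l - C is
    nonnegative, a maximising sequence consists of approximate eigenvectors. Compactness makes C u_n
    Cauchy along a subsequence, and [l > 0] allows u_n to be recovered from C u_n. *)
Lemma compact_symmetric_eigenvector (M : set V) (C : V -> V) (c : R) v0 :
  complete_sqn ip -> subspace M -> closed_sqn ip M ->
  (forall u, M u -> M (C u)) ->
  (forall u v, M u -> M v -> ip (C u) v = ip u (C v)) ->
  0 <= c -> (forall u, M u -> N (C u) <= c * N u) ->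
  tot_bounded ip [set C u | u in [set u | M u /\ N u <= 1]] ->
  M v0 -> 0 < ip (C v0) v0 ->
  exists v l, [/\ M v, N v = 1, 0 < l & N (C v - l *: v) = 0].
Proof.
move=> Vc sM clM MC Csym c0 Cc tC Mv0 Cv0.
pose E := [set ip (C u) u | u in [set u | M u /\ N u = 1]].
have CZ a u v : M u -> M v -> ip (C (a *: u)) v = a * ip (C u) v.
  by move=> Mu Mv; rewrite !Csym// ?dotZl//; exact: subspaceZ.
have CD u v y : M u -> M v -> M y -> ip (C (u + v)) y = ip (C u) y + ip (C v) y.
  by move=> Mu Mv My; rewrite !Csym// ?dotDl//; exact: subspaceD.
have Cle u : M u -> `|ip (C u) u| <= (c + 1) * N u.
  move=> Mu; have := Cc _ Mu; rewrite ler_norml.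
  have := sqn_ge0 ip (C u + u); have := sqn_ge0 ip (C u - u).
  have := mulr_ge0 c0 (sqn_ge0 ip u).
  by rewrite !sqnD sqnN dotNr => *; apply/andP; split; nra.
have unit_dir u : M u -> N u != 0 -> exists e, [/\ M e, N e = 1 &
    ip (C e) e = ip (C u) u / N u].
  move=> Mu u0; exists ((Num.sqrt (N u))^-1 *: u); split.
  - exact: subspaceZ.
  - exact: sqn_normalize.
  - rewrite CZ//; last exact: subspaceZ.
    by rewrite dotZr mulrA -expr2 exprVn sqr_sqrtr ?sqn_ge0// mulrC.
have v0n : N v0 != 0 by apply/negP => /eqP /(dot_sqn0r (C v0)) h; rewrite h ltxx in Cv0.
have N0 : 0 < N v0 by rewrite lt_neqAle eq_sym v0n sqn_ge0.
have [e1 [Me1 e11 Ce1]] := unit_dir v0 Mv0 v0n.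
have ubE : has_ubound E.
  exists (c + 1) => _ [u [Mu u1] <-].
  by have := Cle u Mu; rewrite u1 mulr1; apply: le_trans; exact: ler_norm.
have supE : has_sup E by split=> //; exists (ip (C e1) e1); exists e1.
have [l lE] : exists l, l = sup E by exists (sup E).
have l0 : 0 < l.
  rewrite lE.
  apply: (@lt_le_trans _ _ (ip (C e1) e1)); first by rewrite Ce1 divr_gt0.
  by apply: ub_le_sup => //; exists e1.
have quad u : M u -> 0 <= l * N u - ip (C u) u.
  move=> Mu; rewrite subr_ge0; have [u0|u0] := eqVneq (N u) 0.
    by rewrite u0 mulr0 dot_sqn0r.
  have [e [Me e1' Ce]] := unit_dir u Mu u0.
  rewrite -ler_pdivrMr ?lt_neqAle ?sqn_ge0 1?eq_sym ?u0// -Ce lE.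
  by apply: ub_le_sup => //; exists e.
pose K := l + c + 1.
have K0 : 0 < K by rewrite /K; lra.
(* Cauchy-Schwarz for q(x) = l N(x) - <C x, x>: with w = l u - C u, nonnegativity of q on the line u
   + t w gives N(w)^2 <= q(u) q(w), and q(w) <= K N(w). *)
have key u : M u -> N (l *: u - C u) <= K * (l * N u - ip (C u) u).
  move=> Mu; have [w wE] : exists w, w = l *: u - C u by exists (l *: u - C u).
  rewrite -wE; have Mw : M w by rewrite wE; apply: subspaceB => //; [exact: subspaceZ|exact: MC].
  have /discr_le0 : forall t : R, 0 <= (l * N u - ip (C u) u)
      + 2 * N w * t + (l * N w - ip (C w) w) * t ^+ 2.
    move=> t; have Mt : M (t *: w) by exact: subspaceZ.
    have Mut := subspaceD sM Mu Mt.
    have := quad _ Mut; rewrite (CD _ _ _ Mu Mt Mut) (CZ _ _ _ Mw Mut).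
    rewrite !dotDr !dotZr (Csym w u)// (dotC ip w (C u)) sqnD sqnZ dotZr.
    have -> : N w = l * ip u w - ip (C u) w by rewrite /sqn {1}wE dotDl dotNl dotZl.
    by lra.
  have := quad u Mu; have := sqn_ge0 ip w.
  have : l * N w - ip (C w) w <= K * N w.
    by have := Cle w Mw; rewrite ler_norml /K => /andP[+ _]; lra.
  move: (N w) (l * N u - _) (l * N w - _) => z x y yK z0 x0 zxy.
  have [->|zn0] := eqVneq z 0; first by rewrite mulr_ge0// ltW.
  have zp : 0 < z by rewrite lt_neqAle eq_sym zn0.
  by rewrite -(ler_pM2r zp); nra.
have /choice[u uP] : forall n : nat, exists u, [/\ M u, N u = 1 &
    l - n.+1%:R^-1 < ip (C u) u].
  move=> n; have n0 : 0 < n.+1%:R^-1 :> R by [].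
  by have [_ [u [Mu u1] <-]] := sup_adherent n0 supE; rewrite -lE; exists u.
have [f fj fC] : exists2 f : nat -> nat, (forall j, (j <= f j)%N) &
    cauchy_sqn ip ((C \o u) \o f).
  apply: tot_bounded_subseq tC _ => n; exists (u n) => //.
  by have [Mu u1 _] := uP n; rewrite /= u1.
have Bu e : 0 < e -> exists n0, forall n, (n0 <= n)%N ->
    N (l *: u (f n) - C (u (f n))) <= e.
  move=> e0; have eK : 0 < e / K by rewrite divr_gt0.
  have [n0 n0P] := harmonic_small eK; exists n0 => n n0n.
  have [Mu u1 ltu] := uP (f n); apply: le_trans (key _ Mu) _.
  rewrite u1 mulr1 mulrC -ler_pdivlMr//.
  apply: le_trans (n0P (f n) (leq_trans n0n (fj n))).
  by move: (f n).+1%:R^-1 ltu => *; lra.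
have [e e0|v uv] := Vc (u \o f).
  (* Going from l u_i to l u_j through C u_i and C u_j costs 2 + 2 (2 + 2) = 10 times the common
     bound. *)
  have le0 : 0 < e * l ^+ 2 / 10 by rewrite divr_gt0// mulr_gt0// exprn_gt0.
  have [n1 n1P] := Bu _ le0; have [n2 n2P] := fC _ le0.
  exists (maxn n1 n2) => i j; rewrite !geq_max => /andP[i1 i2] /andP[j1 j2] /=.
  rewrite -(@ler_pM2l _ (l ^+ 2)) ?exprn_gt0// -sqnZ.
  have := n1P i i1; have := n1P j j1; have := n2P i j i2 j2 => /=.
  have := sqn_triangle ip (C (u (f i))) (l *: u (f i)) (l *: u (f j)).
  have := sqn_triangle ip (C (u (f j))) (C (u (f i))) (l *: u (f j)).
  rewrite [N (C (u (f j)) - l *: _)]sqnB scalerBr => *; lra.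
have Mv : M v by apply: cvg_closed uv => // n; have [] := uP (f n).
exists v, l; split=> //.
  apply/eqP; rewrite -subr_eq0; apply/eqP/eq0_sqr_le => e e0.
  (* Below, y^2 <= x <= d <= 1, so (x - 2y)^2 <= 2 x^2 + 8 y^2 <= 10 d. *)
  pose d := Num.min 1 (e / 10).
  have d0 : 0 < d by rewrite lt_min ltr01/=; lra.
  have d1 : d <= 1 by rewrite ge_min lexx.
  have d2 : d <= e / 10 by rewrite ge_min lexx orbT.
  have [n nP] := uv d d0; have := nP n (leqnn n) => /=; have [_ u1 _] := uP (f n).
  have := dot_CauchySchwarz ip (u (f n) - v) (u (f n)); rewrite u1 mulr1.
  have -> : N v = N (u (f n)) - 2 * ip (u (f n) - v) (u (f n)) + N (u (f n) - v).
    by rewrite /sqn !dotE (dotC ip v); ring.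
  rewrite u1.
  have := sqn_ge0 ip (u (f n) - v).
  move: (N _) (ip _ _) => x y x0 yx xd.
  have -> : 1 - 2 * y + x - 1 = x - 2 * y by ring.
  by have := sqr_ge0 (x + 2 * y); nra.
apply: (@eq0_ge0_le _ _ (2 + 4 * (c + l ^+ 2))) => [|e e0]; first exact: sqn_ge0.
have [n1 n1P] := Bu e e0; have [n2 n2P] := uv e e0.
pose n := maxn n1 n2; have [Mu _ _] := uP (f n).
have := n1P n (leq_maxl _ _); have := n2P n (leq_maxr _ _) => /=.
have := sqnD_le ip (C v - C (u (f n)) + l *: (u (f n) - v)) (C (u (f n)) - l *: u (f n)).
have := sqnD_le ip (C v - C (u (f n))) (l *: (u (f n) - v)).
have := symmetric_lipschitz sM MC Csym Cc Mv Mu; rewrite [N (v - _)]sqnB sqnZ.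
rewrite [N (C (u (f n)) - l *: _)]sqnB.
rewrite (_ : _ + _ + (C (u (f n)) - _) = C v - l *: v); last first.
  by rewrite scalerBr addrAC !addrA !subrK.
have := sqn_ge0 ip (u (f n) - v); have := sqr_ge0 l.
move: (l ^+ 2) (N (C v - C _)) (N (u (f n) - v)) => q x y q0 y0 xy h1 h2 ye h4.
have : c * y <= c * e by exact: ler_wpM2l.
have : q * y <= q * e by exact: ler_wpM2l.
by lra.
Qed.

End CompactSymmetric.

(** * Eigenvectors of the action *)

Section Eigenpairs.
Context (R : realType) (V : lmodType R) (ip : semi_inner_product V).
Context (U : isometric_Zaction ip).
Local Notation N := (sqn ip).
Implicit Types (u v w f h : V).

(* h1 + i h2 is an eigenvector of the complexification of [U 1], with eigenvalue a + i b. *)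
Definition eigenpair h1 h2 := exists a b : R,
  N (U 1 h1 - (a *: h1 - b *: h2)) = 0 /\ N (U 1 h2 - (a *: h2 + b *: h1)) = 0.

(* Testing h1 is enough, since (h2, - h1) is an eigenpair whenever (h1, h2) is. *)
Definition eigen_orth : set V := [set f | forall h1 h2, eigenpair h1 h2 -> ip f h1 = 0].

Lemma sqn0_dotE u v w : N (u - v) = 0 -> ip u w = ip v w.
Proof.
by move=> /(dot_sqn0l w); rewrite dotDl dotNl => /eqP; rewrite subr_eq0 => /eqP.
Qed.

Lemma sqn0_ext u v : (forall w, ip u w = ip v w) -> N (u - v) = 0.
Proof. by move=> uv; rewrite /sqn dotDl dotNl uv subrr. Qed.

Lemma act_adj n u v : ip (U n u) v = ip u (U (- n) v).
Proof. by rewrite -(act_dot U (- n) (U n u)) actM addNr act0. Qed.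

Lemma eigenpair_act n h1 h2 : eigenpair h1 h2 -> eigenpair (U n h1) (U n h2).
Proof.
move=> [a [b [e1 e2]]]; exists a, b; split.
  by rewrite actM (addrC 1 n) -actM -!actZ -!actB act_sqn.
by rewrite actM (addrC 1 n) -actM -!actZ -actD -actB act_sqn.
Qed.

(** This makes the orthogonal complement of the eigenvectors stable under H. Linearity of H is
    replaced by moving H onto a test vector and back. *)
Lemma eigenpair_symmetric (H : V -> V) h1 h2 :
  (forall u v, ip (H u) v = ip u (H v)) ->
  (forall n u, N (U n (H u) - H (U n u)) = 0) ->
  eigenpair h1 h2 -> eigenpair (H h1) (H h2).
Proof.
move=> Hs HU [a [b [e1 e2]]]; exists a, b; split; apply: sqn0_ext => w.
  by rewrite (sqn0_dotE _ (HU 1 h1)) Hs (sqn0_dotE _ e1) !dotE -!Hs.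
by rewrite (sqn0_dotE _ (HU 1 h2)) Hs (sqn0_dotE _ e2) !dotE -!Hs.
Qed.

Lemma eigen_orth_subspace : subspace eigen_orth.
Proof.
split=> [h1 h2 _|a u v Mu Mv h1 h2 h]; first exact: dot0l.
by rewrite !dotE (Mu _ _ h) (Mv _ _ h) mulr0 addr0.
Qed.

Lemma dot_approx0 u h : (forall e : R, 0 < e -> exists2 v, ip v h = 0 & N (u - v) <= e) ->
  ip u h = 0.
Proof.
move=> uh; have N0 := sqn_ge0 ip h; apply: eq0_sqr_le => e e0.
have d0 : 0 < e / (N h + 1) by rewrite divr_gt0//; lra.
have [v vh uv] := uh _ d0.
have -> : ip u h = ip (u - v) h by rewrite dotDl dotNl vh subr0.
apply: le_trans (dot_CauchySchwarz _ _ _) _.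
apply: le_trans (ler_wpM2r N0 uv) _; rewrite mulrAC ler_pdivrMr; last lra.
by rewrite ler_pM2l//; lra.
Qed.

Lemma eigen_orth_closed : closed_sqn ip eigen_orth.
Proof.
move=> v vM h1 h2 h; apply: dot_approx0 => e /vM[w Mw vw].
by exists w => //; exact: (Mw h1 h2).
Qed.

Lemma eigen_orth_act n f : eigen_orth f -> eigen_orth (U n f).
Proof. by move=> Mf h1 h2 /(eigenpair_act (- n)) h; rewrite act_adj; exact: Mf h. Qed.

(* With b^2 = 1 - a^2, the relation v_1 + v_{-1} = 2 a v says that (U - (a - i b)) v is
   an eigenvector of U for a + i b; multiplied by -i it is the pair below. *)
Lemma eigenpair_of_real_part (a b : R) v : a ^+ 2 + b ^+ 2 = 1 ->
  N (U 1 v + U (-1) v - (2 * a) *: v) = 0 ->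
  eigenpair (b *: v) (a *: v - U 1 v).
Proof.
move=> ab1 va; exists a, b; split; apply: sqn0_ext => w.
  by rewrite actZ !dotE; ring.
rewrite actB actZ !dotE [ip (U 1 (U 1 v)) w]act_adj.
have := sqn0_dotE (U (-1) w) va; rewrite !dotE (act_adj (-1)) actM opprK act0 => h.
have {h} -> : ip (U 1 v) (U (-1) w) = 2 * a * ip v (U (-1) w) - ip v w by rewrite -h; ring.
rewrite [ip (U 1 v) w]act_adj.
have -> : b * (b * ip v w) = (1 - a ^+ 2) * ip v w by rewrite -ab1; ring.
by ring.
Qed.

Lemma almost_periodic_eigen_orth_null f : complete_sqn ip ->
  almost_periodic U f -> eigen_orth f -> N f = 0.
Proof.
move=> Vc apf Mf; apply: contrapT => f0.
have /not_flightP[s [e [e0 fe]]] : ~ flight U f.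
  by move=> /(almost_periodic_flight_null apf).
have [H [Hs HU Hc [c c0 Hb] /(_ f e fe) Hf]] := invariant_compact_operator U s Vc.
have MH u : eigen_orth u -> eigen_orth (H u).
  by move=> Mu h1 h2 /(eigenpair_symmetric Hs HU) h; rewrite Hs; exact: Mu h.
have [x [l [Mx x1 l0 Hx]]] : exists v l,
    [/\ eigen_orth v, N v = 1, 0 < l & N (H v - l *: v) = 0].
  apply: (@compact_symmetric_eigenvector _ _ ip eigen_orth H c f) => //.
  - exact: eigen_orth_subspace.
  - exact: eigen_orth_closed.
  - apply: tot_bounded_lipschitz (Hc 1); first exact: ltr01.
      by move=> u v; rewrite mul1r; exact: lexx.
    by move=> _ [u [_ u1] <-]; exists (H u); [exists u|rewrite subrr /sqn dot0l].
  - exact: lt_le_trans Hf.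
pose M := [set u | eigen_orth u /\ N (H u - l *: u) = 0].
(* U + U^-1 >= -2 on the symmetric form, so the shift by 3 gives <C x, x> >= N(x) > 0 and makes the
   eigenvalue criterion applicable. The bound 26 is 2 * 9 + 2 * (2 + 2). *)
pose C u := 3 *: u + (U 1 u + U (-1) u).
have CB u v : C (u - v) = C u - C v.
  by rewrite /C scalerBr !actB !opprD [RHS]addrACA [X in _ = _ + X]addrACA.
have Cle u : N (C u) <= 26 * N u.
  have := sqnD_le ip (3 *: u) (U 1 u + U (-1) u).
  by have := sqnD_le ip (U 1 u) (U (-1) u); rewrite sqnZ !act_sqn; lra.
have sM : subspace M.
  have [M0 MD] := eigen_orth_subspace.
  split.
    split; first exact: M0.
    by apply: sqn0_ext => w; rewrite Hs !dotE mulr0.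
  move=> a u v [Mu Hu] [Mv Hv]; split.
    exact: MD.
  apply: sqn0_ext => w; rewrite Hs !dotE -!Hs (sqn0_dotE w Hu) (sqn0_dotE w Hv) !dotE.
  by ring.
have MU n u : M u -> M (U n u).
  move=> [Mu Hu]; split; first exact: eigen_orth_act.
  apply: sqn0_ext => w; rewrite -(sqn0_dotE w (HU n u)) act_adj (sqn0_dotE _ Hu).
  by rewrite !dotE -act_adj.
have clM : closed_sqn ip M.
  move=> v vM; split.
    by apply: eigen_orth_closed => d /vM[w [Mw _] vw]; exists w.
  apply: sqn0_ext => w; rewrite Hs.
  suff : ip v (H w - l *: w) = 0 by rewrite !dotE => /eqP; rewrite subr_eq0 => /eqP.
  apply: dot_approx0 => d /vM[u [_ Hu] vu]; exists u => //.
  by rewrite dotDr dotNr -Hs (sqn0_dotE _ Hu) !dotE subrr.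
have [v [m [[Mv _] v1 m0 Cv]]] : exists v m,
    [/\ M v, N v = 1, 0 < m & N (C v - m *: v) = 0].
  apply: (@compact_symmetric_eigenvector _ _ ip M C 26 x) => //.
  - move=> u Mu; apply: subspaceD => //; first exact: subspaceZ.
    by apply: subspaceD => //; exact: MU.
  - by move=> u v _ _; rewrite /C !dotE !act_adj opprK; ring.
  (* On M the operator H is multiplication by l, so u agrees with l^-1 H u up to a null vector: the
     compactness of H is transferred to C on the unit ball of M. *)
  - apply: (@tot_bounded_lipschitz _ _ _ _ _ (26 * (l^-1) ^+ 2) (fun w => C (l^-1 *: w)))
      (Hc 1).
    + by rewrite mulr_gt0// exprn_gt0// invr_gt0.
    + move=> u v; rewrite -CB -scalerBr; apply: le_trans (Cle _) _.
      by rewrite sqnZ mulrA.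
    + move=> _ [u [[_ Hu] u1] <-]; exists (H u); first by exists u.
      rewrite -CB; apply/eqP; rewrite eq_le sqn_ge0 andbT.
      apply: le_trans (Cle _) _.
      have -> : u - l^-1 *: H u = - l^-1 *: (H u - l *: u).
        by rewrite scaleNr scalerBr scalerA mulVf ?gt_eqF// scale1r opprB.
      by rewrite sqnZ Hu !mulr0.
  - rewrite /C !dotE (act_adj (-1)) opprK (dotC ip x (U 1 x)) -/(N x) x1.
    by have := sqn_ge0 ip (U 1 x + x); rewrite sqnD act_sqn x1; lra.
have va : N (U 1 v + U (-1) v - (2 * ((m - 3) / 2)) *: v) = 0.
  apply: sqn0_ext => w; have := sqn0_dotE w Cv; rewrite /C !dotE.
  by move=> h; have -> : ip (U 1 v) w + ip (U (-1) v) w = m * ip v w - 3 * ip v w;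
    [rewrite -h; ring|field].
move: ((m - 3) / 2) va => a va.
have aE : ip (U 1 v) v = a.
  have := sqn0_dotE v va; rewrite !dotE (act_adj (-1)) opprK (dotC ip v (U 1 v)).
  by rewrite -/(N v) v1; lra.
have a1 : a ^+ 2 <= 1.
  by have := dot_CauchySchwarz ip (U 1 v) v; rewrite aE act_sqn v1 mulr1.
pose b := Num.sqrt (1 - a ^+ 2).
have b2 : b ^+ 2 = 1 - a ^+ 2 by rewrite sqr_sqrtr// subr_ge0.
have ab1 : a ^+ 2 + b ^+ 2 = 1 by rewrite b2; ring.
(* The first component of this eigenpair is b v, and v is orthogonal to it, so b = 0. Then a^2 = 1,
   and the equality case of Cauchy-Schwarz makes v itself an eigenvector, which contradicts N(v) =
   1. *)
have := Mv _ _ (eigenpair_of_real_part ab1 va).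
rewrite dotZr -/(N v) v1 mulr1 => b0.
have : eigenpair v 0.
  exists a, 0; split; last by rewrite act_zero !scaler0 scale0r addr0 subr0 /sqn dot0l.
  rewrite scaler0 subr0 sqnD act_sqn sqnN dotNr dotZr aE sqnZ v1.
  by move: b2; rewrite b0 expr0n/=; lra.
by move=> /Mv; rewrite -/(N v) v1 => /eqP; rewrite oner_eq0.
Qed.

End Eigenpairs.

(** * The space L^2(mu) *)

Section SquareIntegrable.
Context (d : measure_display) (X : measurableType d) (R : realType).
Context (mu : probability X R).

Fact le12 : (1 <= 2%:E :> \bar R)%E. Proof. by rewrite lee_fin ler1n. Qed.

Definition L2 := LfunType mu le12.
HB.instance Definition _ := GRing.Lmodule.on L2.

Implicit Types (f g u v : L2).

Definition L2fun f : X -> R := f.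

Lemma L2_measurable f : measurable_fun setT (L2fun f).
Proof. exact: measurable_funPT. Qed.

Lemma L2_integrableM f g : mu.-integrable setT (EFin \o (fun x => L2fun f x * L2fun g x)).
Proof.
by apply/(Lfun1_integrable mu); apply: Lfun2_mul_Lfun1; exact: LfunP.
Qed.

Lemma Lfun2P (f : X -> R) : measurable_fun setT f ->
  (\int[mu]_x ((f x) ^+ 2)%:E < +oo)%E -> f \in Lfun mu 2%:E.
Proof.
move=> mf fy; rewrite inE; apply/andP; split; rewrite inE//=.
rewrite /finite_norm unlock /Lnorm poweR_lty//.
rewrite (eq_integral (fun x => (f x ^+ 2)%:E))// => x _ /=.
by rewrite powR_mulrn// real_normK ?num_real.
Qed.

Lemma L2_funD f g x : L2fun (f + g) x = L2fun f x + L2fun g x. Proof. by []. Qed.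
Lemma L2_funB f g x : L2fun (f - g) x = L2fun f x - L2fun g x. Proof. by []. Qed.
Lemma L2_funZ a f x : L2fun (a *: f) x = a * L2fun f x. Proof. by []. Qed.

Definition mkL2 (f : X -> R) (mf : measurable_fun setT f)
  (fy : (\int[mu]_x ((f x) ^+ 2)%:E < +oo)%E) : L2 := Lfun_Sub le12 (Lfun2P mf fy).

Definition L2dot f g : R := \int[mu]_x (L2fun f x * L2fun g x).

Lemma L2dotC f g : L2dot f g = L2dot g f.
Proof. by rewrite /L2dot; congr fine; apply: eq_integral => x _; rewrite mulrC. Qed.

Lemma L2dotDl f g h : L2dot (f + g) h = L2dot f h + L2dot g h.
Proof.
rewrite /L2dot -RintegralD//; [|exact: L2_integrableM..].
by apply: eq_Rintegral => x _; rewrite L2_funD mulrDl.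
Qed.

Lemma L2dotZl a f g : L2dot (a *: f) g = a * L2dot f g.
Proof.
rewrite /L2dot -RintegralZl//; last exact: L2_integrableM.
by apply: eq_Rintegral => x _; rewrite L2_funZ mulrA.
Qed.

Lemma L2dot_ge0 f : 0 <= L2dot f f.
Proof. by apply: Rintegral_ge0 => x _; rewrite -expr2 sqr_ge0. Qed.

Definition L2ip : semi_inner_product L2 :=
  SemiInnerProduct L2dotC L2dotDl L2dotZl L2dot_ge0.

Lemma L2_sqnE f : (sqn L2ip f)%:E = (\int[mu]_x ((L2fun f x) ^+ 2)%:E)%E.
Proof.
rewrite /sqn /= /L2dot fineK.
  by apply: eq_integral => x _ /=; rewrite expr2.
by apply: integrable_fin_num => //; exact: L2_integrableM.
Qed.

Lemma L2_sqn0_ae f : sqn L2ip f = 0 -> {ae mu, forall x, L2fun f x = 0}.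
Proof.
move=> f0; have := L2_sqnE f; rewrite f0.
have mf : measurable_fun setT (fun x => (L2fun f x ^+ 2)%:E).
  by apply/measurable_EFinP; apply: measurable_funX; exact: L2_measurable.
move=> /esym h.
have : (\int[mu]_x `|(L2fun f x ^+ 2)%:E| = 0)%E.
  by rewrite -[RHS]h; apply: eq_integral => x _; rewrite gee0_abs// lee_fin sqr_ge0.
move=> /(ae_eq_integral_abs mu measurableT mf).
apply: filterS => x /(_ I) /= [/eqP]; rewrite sqrf_eq0 => /eqP //.
Qed.

Lemma L2_ae_sqn0 f : {ae mu, forall x, L2fun f x = 0} -> sqn L2ip f = 0.
Proof.
move=> f0; apply: EFin_inj; rewrite L2_sqnE.
rewrite -[RHS](integral0 mu setT); apply: ae_eq_integral => //.
  by apply/measurable_EFinP; apply: measurable_funX; exact: L2_measurable.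
by apply: filterS f0 => x fx _; rewrite /= fx expr0n.
Qed.

End SquareIntegrable.
Arguments L2fun : simpl never.
Arguments mkL2 : simpl never.

(** * Completeness of L^2 *)

Section RieszFischer.
Context (d : measure_display) (X : measurableType d) (R : realType).
Context (mu : probability X R).
Local Notation N := (sqn (L2ip mu)).

Lemma measurable_sqr_EFin (f : X -> R) : measurable_fun setT f ->
  measurable_fun setT (fun x => ((f x) ^+ 2)%:E).
Proof. by move=> mf; apply/measurable_EFinP; exact: measurable_funX. Qed.

Lemma ae_eq_integral_sqr (f g : X -> R) :
  measurable_fun setT f -> measurable_fun setT g -> {ae mu, forall x, f x = g x} ->
  (\int[mu]_x ((f x) ^+ 2)%:E = \int[mu]_x ((g x) ^+ 2)%:E)%E.
Proof.
move=> mf mg fg; apply: ae_eq_integral => //; [exact: measurable_sqr_EFin..|].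
by apply: filterS fg => x -> _.
Qed.

Lemma limn_einf_le (a : nat -> \bar R) (b : \bar R) : (forall k, a k <= b)%E ->
  (limn_einf a <= b)%E.
Proof.
move=> ab; rewrite limn_einf_lim; apply: lime_le; first exact: is_cvg_einfs.
apply: nearW => n; apply: le_trans (ab n).
by apply: ereal_inf_lbound; exists n => /=.
Qed.

Lemma fatou_sqr (F : nat -> X -> R) (f : X -> R) (B : \bar R) :
  (forall k, measurable_fun setT (F k)) -> (forall x, F ^~ x @ \oo --> f x) ->
  (forall k, \int[mu]_x ((F k x) ^+ 2)%:E <= B)%E ->
  (\int[mu]_x ((f x) ^+ 2)%:E <= B)%E.
Proof.
move=> mF Ff FB; apply: le_trans (limn_einf_le FB).
apply: le_trans (fatou mu measurableT _ _).
- rewrite le_eqVlt; apply/orP; left; apply/eqP; apply: eq_integral => x _.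
  have /cvg_limn_einf_sup[-> _]// : ((F k x) ^+ 2)%:E @[k --> \oo] --> ((f x) ^+ 2)%:E.
  apply: cvg_EFin; first exact: nearW.
  rewrite expr2 (_ : _ \o _ = (fun k => F k x * F k x)).
    by apply: cvgM; exact: Ff.
  by apply/funext => k /=; rewrite expr2.
- by move=> k; exact: measurable_sqr_EFin.
- by move=> k x _; rewrite lee_fin sqr_ge0.
Qed.

Lemma sum_half (n : nat) : \sum_(0 <= k < n) (2^-1 : R) ^+ k <= 2.
Proof.
suff -> : \sum_(0 <= k < n) (2^-1 : R) ^+ k = 2 - 2 * 2^-1 ^+ n.
  have : 0 <= (2^-1 : R) ^+ n by exact: exprn_ge0.
  lra.
elim: n => [|n IHn]; first by rewrite big_geq// expr0; ring.
by rewrite big_nat_recr//= IHn exprS; field.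
Qed.

(** The increments are absolutely summable because z <= 2^-k + 2^k z^2; the weight 2^k thus avoids
    square roots. *)
Lemma cvg_of_weighted_sqr (w : nat -> R) :
  (\sum_(k <oo) (2 ^+ k * (w k.+1 - w k) ^+ 2)%:E < +oo)%E -> cvgn w.
Proof.
set S := (X in (X < _)%E) => Sy.
have t0 k : (0 <= (2 ^+ k * (w k.+1 - w k) ^+ 2)%:E :> \bar R)%E.
  by rewrite lee_fin mulr_ge0 ?sqr_ge0 ?exprn_ge0.
have Sfin : S \is a fin_num by rewrite ge0_fin_numE//; exact: nneseries_ge0.
have sle n : \sum_(0 <= k < n) 2 ^+ k * (w k.+1 - w k) ^+ 2 <= fine S.
  rewrite -lee_fin fineK// -sumEFin.
  by apply: (@nneseries_lim_ge _ (fun k => (2 ^+ k * (w k.+1 - w k) ^+ 2)%:E)) => k _ _.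
have cs : cvgn (series (fun k => w k.+1 - w k)).
  apply: normed_cvg; apply: nondecreasing_is_cvgn.
    by apply: nondecreasing_series => k *; exact: normr_ge0.
  exists (2 + fine S) => _ [n _ <-] /=; rewrite /series /=.
  apply: le_trans (lerD (sum_half n) (sle n)).
  rewrite -big_split; apply: ler_sum => k _ /=.
  have h1 : 0 < (2 : R) ^+ k by exact: exprn_gt0.
  have h2 : (2 : R)^-1 ^+ k * 2 ^+ k = 1 by rewrite -exprMn mulVf// expr1n.
  have := normr_ge0 (w k.+1 - w k); rewrite -[(w k.+1 - w k) ^+ 2]real_normK ?num_real//.
  move: (2 ^+ k) (2^-1 ^+ k) (`|_|) h1 h2 => p q z p0 qp z0.
  have q0 : 0 < q by rewrite -(pmulr_lgt0 _ p0) qp.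
  have -> : q + p * z ^+ 2 = q * (1 + (p * z) ^+ 2).
    by rewrite mulrDr mulr1 exprMn [p ^+ 2]expr2 !mulrA qp mul1r.
  rewrite [leLHS](_ : z = q * (p * z)); last by rewrite mulrA qp mul1r.
  by rewrite ler_pM2l//; move: (p * z) => y; have := sqr_ge0 (y - 1); nra.
have -> : w = (fun n => w 0%N + series (fun k => w k.+1 - w k) n).
  by apply/funext => n; rewrite /series /= telescope_sumr// addrC subrK.
by apply: is_cvgD => //; exact: is_cvg_cst.
Qed.

(** Along a subsequence with square distances at most 4^-k, the weighted sum [S] has integral at
    most the sum of 2^k 4^-k, so it is finite almost everywhere and the subsequence converges there.
    Fatou's lemma bounds the distance to the limit. *)
Lemma L2_complete : complete_sqn (L2ip mu).
Proof.
move=> u cu.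
have /choice[nk nkP] : forall k : nat, exists n, forall i j, (n <= i)%N -> (n <= j)%N ->
    N (u i - u j) <= 4^-1 ^+ k.
  by move=> k; apply: cu; rewrite exprn_gt0.
(* Partial sums make the indices monotone and at least [nk k]; the [+ 1] forces [k <= m k]. *)
pose m k := (\sum_(i < k.+1) (nk i + 1))%N.
have mS k : (m k <= m k.+1)%N by rewrite /m [X in (_ <= X)%N]big_ord_recr/= leq_addr.
have mnk k : (nk k <= m k)%N.
  by rewrite /m big_ord_recr/= addnCA leq_addr.
have mk k : (k <= m k)%N.
  elim: k => // k IHk; rewrite /m big_ord_recr/= -/(m k) addnA addn1 ltnS.
  exact: leq_trans IHk (leq_addr _ _).
pose w k : X -> R := L2fun (u (m k)).
have mw k : measurable_fun setT (w k) by exact: L2_measurable.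
have mt k : measurable_fun setT (fun x => (2 ^+ k * (w k.+1 x - w k x) ^+ 2)%:E).
  apply/measurable_EFinP; apply: measurable_funM; first exact: measurable_cst.
  by apply: measurable_funX; apply: measurable_funB; exact: mw.
have t0 k x : (0 <= (2 ^+ k * (w k.+1 x - w k x) ^+ 2)%:E :> \bar R)%E.
  by rewrite lee_fin mulr_ge0 ?sqr_ge0 ?exprn_ge0.
pose S x : \bar R := (\sum_(k <oo) (2 ^+ k * (w k.+1 x - w k x) ^+ 2)%:E)%E.
have mS' : measurable_fun setT S.
  by apply: (@ge0_emeasurable_sum _ _ _ setT
    (fun k x => (2 ^+ k * (w k.+1 x - w k x) ^+ 2)%:E) xpredT).
have S0 x : (0 <= S x)%E by apply: nneseries_ge0.
have Sint : (\int[mu]_x S x <= 2%:E)%E.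
  rewrite /S integral_nneseries//.
  apply: lime_le; first by apply: is_cvg_nneseries => k _ _; apply: integral_ge0.
  apply: nearW => n; apply: (@le_trans _ _ (\sum_(0 <= k < n) (2^-1 ^+ k)%:E)%E); last first.
    by rewrite sumEFin lee_fin sum_half.
  apply: lee_sum => k _.
  under eq_integral do rewrite EFinM.
  rewrite ge0_integralZl_EFin ?exprn_ge0//; last 2 first.
  - by move=> x _; rewrite lee_fin sqr_ge0.
  - by apply: measurable_sqr_EFin; apply: measurable_funB; exact: mw.
  have -> : (\int[mu]_x ((w k.+1 x - w k x) ^+ 2)%:E = (N (u (m k.+1) - u (m k)))%:E)%E.
    by rewrite L2_sqnE.
  rewrite -EFinM lee_fin.
  have := nkP k _ _ (leq_trans (mnk k) (mS k)) (mnk k).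
  have -> : (4^-1 : R) ^+ k = 2^-1 ^+ k * 2^-1 ^+ k by rewrite -exprMn; congr (_ ^+ _); field.
  have h1 : 0 < (2 : R) ^+ k by exact: exprn_gt0.
  have h2 : (2 : R) ^+ k * 2^-1 ^+ k = 1 by rewrite -exprMn mulfV// expr1n.
  by rewrite -(ler_pM2l h1) mulrA h2 mul1r.
have iS : mu.-integrable setT S.
  apply/integrableP; split => //.
  under eq_integral do rewrite gee0_abs//.
  by apply: le_lt_trans Sint _; rewrite ltry.
pose A := [set x | S x < +oo]%E.
have mA : measurable A.
  by rewrite -[A]setTI; apply: emeasurable_fun_infty_o => //.
have aeA : {ae mu, forall x, A x}.
  by apply: filterS (integrable_ae measurableT iS) => x /(_ I); rewrite ge0_fin_numE.
(* Cutting to A gives convergence at every point, hence a measurable limit, and changes the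
   functions only on a null set. *)
pose h k x := w k x * \1_A x.
have mh k : measurable_fun setT (h k) by apply: measurable_funM => //; exact: measurable_indic.
have hcv x : cvgn (h ^~ x).
  rewrite /h; have [Ax|nAx] := pselect (A x).
    rewrite indicE mem_set//; under eq_fun do rewrite mulr1.
    exact: cvg_of_weighted_sqr.
  rewrite indicE memNset//; under eq_fun do rewrite mulr0.
  exact: is_cvg_cst.
pose v x := limn (h ^~ x).
have hv x : h ^~ x @ \oo --> v x by exact: hcv.
have mv : measurable_fun setT v.
  by apply: (measurable_fun_cvg mh) => x _; exact: hv.
have main (e : R) i : 0 < e -> (forall j, (i <= j)%N -> N (u i - u j) <= e) ->
    (\int[mu]_x ((L2fun (u i) x - v x) ^+ 2)%:E <= e%:E)%E.
  move=> e0 ie.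
  apply: (@fatou_sqr (fun k x => L2fun (u i) x - h (k + i)%N x)).
  - by move=> k; apply: measurable_funB; [exact: L2_measurable|exact: mh].
  - move=> x; apply: cvgB; first exact: cvg_cst.
    by rewrite (cvg_shiftn i (h ^~ x)); exact: hv.
  move=> k; rewrite (@ae_eq_integral_sqr _ (fun x => L2fun (u i - u (m (k + i)%N)) x)).
  - rewrite -L2_sqnE lee_fin; apply: ie.
    exact: leq_trans (leq_addl _ _) (mk _).
  - by apply: measurable_funB; [exact: L2_measurable|exact: mh].
  - exact: L2_measurable.
  - apply: filterS aeA => x Ax.
    by rewrite /h indicE mem_set// mulr1 L2_funB.
have [n0 n0P] := cu 1 ltr01.
have dfin : (\int[mu]_x ((L2fun (u n0) x - v x) ^+ 2)%:E < +oo)%E.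
  apply: le_lt_trans (main 1 n0 ltr01 _) _; last exact: ltry.
  by move=> j nj; exact: n0P.
have md : measurable_fun setT (fun x => L2fun (u n0) x - v x).
  by apply: measurable_funB => //; exact: L2_measurable.
(* Fatou's lemma gives square integrability of [u n0 - v], so the limit enters [L2] as
   [u n0 - D]. *)
pose D := mkL2 md dfin.
exists (u n0 - D) => e e0; have [n1 n1P] := cu e e0; exists n1 => n nn.
rewrite -lee_fin L2_sqnE.
rewrite (eq_integral (fun x => ((L2fun (u n) x - v x) ^+ 2)%:E)).
  by apply: main => // j nj; apply: n1P => //; exact: leq_trans nj.
move=> x _; congr ((_ ^+ 2)%:E); rewrite !L2_funB.
have -> : L2fun D x = L2fun (u n0) x - v x by [].
by ring.
Qed.

End RieszFischer.

(** * Couplings and the Koopman action *)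

Section ProbabilityConstructions.
Context (d : measure_display) (X : measurableType d) (R : realType).

Lemma density_probability (mu : probability X R) (g : X -> R) :
  measurable_fun setT g -> (forall x, 0 <= g x) -> (\int[mu]_x (g x)%:E = 1)%E ->
  exists P : probability X R, forall A, measurable A -> (P A = \int[mu]_(x in A) (g x)%:E)%E.
Proof.
move=> mg g0 g1; pose P (A : set X) := (\int[mu]_(x in A) (g x)%:E)%E.
have P0 : P set0 = 0%E by rewrite /P integral_set0.
have P_ge0 A : (0 <= P A)%E by apply: integral_ge0 => x _; rewrite lee_fin.
have P_add : semi_sigma_additive P.
  move=> A mA tA mUA; rewrite /P ge0_integral_bigcup//.
  - by apply: is_cvg_ereal_nneg_natsum_cond => n _ _; exact: P_ge0.
  - by apply/measurable_EFinP; apply: measurable_funTS.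
  - by move=> x _; rewrite lee_fin.
have PT : P setT = 1%E by [].
pose M := isMeasure.Build _ _ _ P P0 P_ge0 P_add.
pose mP : {measure set X -> \bar R} := HB.pack P M.
pose pP : probability X R := HB.pack P mP (Measure_isProbability.Build _ _ _ mP PT).
by exists pP.
Qed.

Lemma mixture_probability (m1 m2 : {measure set X -> \bar R}) :
  m1 setT = 1%E -> m2 setT = 1%E ->
  exists P : probability X R, forall A, P A = ((2^-1)%:E * (m1 A + m2 A))%E.
Proof.
move=> m11 m21; have h0 : 0 <= 2^-1 :> R by [].
pose P : {measure set X -> \bar R} := mscale (NngNum h0) (measure_add m1 m2).
have PE A : P A = ((2^-1)%:E * (m1 A + m2 A))%E by rewrite -measure_addE.
have PT : P setT = 1%E.
  by rewrite PE m11 m21 -EFinD -EFinM; congr EFin; field.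
pose pP : probability X R :=
  HB.pack (P : set X -> \bar R) P (Measure_isProbability.Build _ _ _ P PT).
by exists pP.
Qed.

End ProbabilityConstructions.

(** * Indicator functions and twisted couplings *)

Section Indicators.
Context (d : measure_display) (X : measurableType d) (R : realType).
Context (mu : probability X R).
Local Notation ip := (L2ip mu).
Local Notation N := (sqn ip).
Implicit Types (A B : set X) (f g : L2 mu).

Lemma L2P f g : (forall x, L2fun f x = L2fun g x) -> f = g.
Proof. by move=> fg; apply/LfuneqP. Qed.

Lemma bounded_integral_sqr (f : X -> R) : measurable_fun setT f ->
  (forall x, `|f x| <= 1) -> (\int[mu]_x ((f x) ^+ 2)%:E < +oo)%E.
Proof.
move=> mf f1; apply: (@le_lt_trans _ _ (\int[mu]_x (cst 1%E x))%E).
  apply: ge0_le_integral => //.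
  - by move=> x _; rewrite lee_fin sqr_ge0.
  - exact: measurable_sqr_EFin.
  - by move=> x _; rewrite lee_fin -real_normK ?num_real// exprn_ile1.
rewrite integral_cst// mul1e.
exact: le_lt_trans (probability_le1 mu measurableT) (ltry 1).
Qed.

Lemma normr_indic_le1 A x : `|\1_A x| <= 1 :> R.
Proof. by rewrite indicE; case: (_ \in _); rewrite ?normr1 ?normr0. Qed.

Definition indL2 A (mA : measurable A) : L2 mu :=
  mkL2 (measurable_indic mA) (bounded_integral_sqr (measurable_indic mA) (normr_indic_le1 A)).

Lemma indL2E A (mA : measurable A) x : L2fun (indL2 mA) x = \1_A x.
Proof. by []. Qed.

Definition oneL2 := indL2 (@measurableT _ X).

Lemma oneL2E x : L2fun oneL2 x = 1.
Proof. by rewrite /oneL2 indL2E indicE in_setT. Qed.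

Lemma dot_indL2 f A (mA : measurable A) :
  (ip f (indL2 mA))%:E = (\int[mu]_(x in A) (L2fun f x)%:E)%E.
Proof.
rewrite /= /L2dot fineK; last by apply: integrable_fin_num => //; exact: L2_integrableM.
by rewrite [RHS]integral_mkcond epatch_indic; apply: eq_integral => x _ /=.
Qed.

Lemma dot_one_indL2 A (mA : measurable A) : (ip oneL2 (indL2 mA))%:E = mu A.
Proof.
rewrite dot_indL2 -[RHS]mul1e -integral_cst//.
by apply: eq_integral => x _; rewrite oneL2E.
Qed.

Lemma indL2_orth_null f : (forall A (mA : measurable A), ip f (indL2 mA) = 0) -> N f = 0.
Proof.
move=> f0; apply: L2_ae_sqn0.
have fi : mu.-integrable setT (EFin \o L2fun f).
  have := L2_integrableM f oneL2; rewrite (_ : _ \o _ = EFin \o L2fun f)//.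
  by apply/funext => x /=; rewrite oneL2E mulr1.
have := @integral_ae_eq _ _ _ mu setT measurableT (cst 0%E) _ fi (@measurable_cst _ _ _ _ _ _).
move=> /(_ _)/wrap[E _ mE|].
  by rewrite integral0 -dot_indL2// f0.
by apply: filterS => x /(_ I) [].
Qed.

(* rho = (1 + f (x) f) (mu x mu), realised as the mean of the squares of the measures
   (1 + f) mu and (1 - f) mu. *)
Lemma twisted_coupling f : (forall x, `|L2fun f x| <= 1) -> ip f oneL2 = 0 ->
  exists rho : probability (X * X)%type R,
    forall A B (mA : measurable A) (mB : measurable B), rho (A `*` B) =
      (ip oneL2 (indL2 mA) * ip oneL2 (indL2 mB)
       + ip f (indL2 mA) * ip f (indL2 mB))%:E.
Proof.
move=> f1 fm.
have oneT : ip oneL2 oneL2 = 1.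
  by apply: EFin_inj; rewrite dot_one_indL2 (probability_setT mu).
have dens g : (forall x, `|L2fun g x| <= 1) -> ip g oneL2 = 0 ->
    exists P : probability X R, forall A (mA : measurable A),
      P A = (ip oneL2 (indL2 mA) + ip g (indL2 mA))%:E.
  move=> g1 gm; have [|||P PE] := @density_probability _ X R mu (L2fun (oneL2 + g)).
  - exact: L2_measurable.
  - move=> x; rewrite L2_funD oneL2E; have := g1 x; rewrite ler_norml; lra.
  - by rewrite -dot_indL2 dotDl oneT gm addr0.
  - by exists P => A mA; rewrite PE// -dot_indL2 dotDl.
have [P1 P1E] := dens f f1 fm.
have [||P2 P2E] := dens (- f).
- by move=> x; rewrite (_ : L2fun (- f) x = - L2fun f x)// normrN.
- by rewrite dotNl fm oppr0.
have [||rho rhoE] := @mixture_probability _ _ R (P1 \x P1)%E (P2 \x P2)%E.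
- by rewrite -setXTT [LHS]product_measure1E// [X in (X * _)%E](probability_setT P1)
    [X in (_ * X)%E](probability_setT P1) mule1.
- by rewrite -setXTT [LHS]product_measure1E// [X in (X * _)%E](probability_setT P2)
    [X in (_ * X)%E](probability_setT P2) mule1.
exists rho => A B mA mB; rewrite rhoE.
rewrite [X in (_ * (X + _))%E](product_measure1E _ _ mA mB).
rewrite [X in (_ * (_ + X))%E](product_measure1E _ _ mA mB).
rewrite [X in (_ * (X * _ + _))%E](P1E _ mA) [X in (_ * (_ * X + _))%E](P1E _ mB).
rewrite [X in (_ * (_ + X * _))%E](P2E _ mA) [X in (_ * (_ + _ * X))%E](P2E _ mB).
rewrite [X in _ = X%:E](_ : _ = 2^-1 * ((ip oneL2 (indL2 mA) + ip f (indL2 mA)) *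
    (ip oneL2 (indL2 mB) + ip f (indL2 mB)) + (ip oneL2 (indL2 mA) + ip (- f) (indL2 mA)) *
    (ip oneL2 (indL2 mB) + ip (- f) (indL2 mB)))) //.
by rewrite !dotNl; field.
Qed.

End Indicators.

Lemma Tpow1D (X : Type) (T Tinv : X -> X) : cancel T Tinv -> cancel Tinv T ->
  forall n x, Tpow T Tinv (1 + n) x = T (Tpow T Tinv n x).
Proof.
move=> TK TinvK [n|[|n]] x; rewrite /Tpow /=.
- by [].
- by rewrite TinvK.
- by rewrite TinvK subn1.
Qed.

Lemma TpowD (X : Type) (T Tinv : X -> X) : cancel T Tinv -> cancel Tinv T ->
  forall m n x, Tpow T Tinv (m + n) x = Tpow T Tinv m (Tpow T Tinv n x).
Proof.
move=> TK TinvK m n x; have TS := Tpow1D TK TinvK.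
have TP k y : Tpow T Tinv (-1 + k) y = Tinv (Tpow T Tinv k y).
  by rewrite -[in RHS](addKr (-1) k) opprK TS TK.
elim/int_rect: m => [|m IHm|m IHm]; first by rewrite add0r.
  by rewrite intS -addrA !TS IHm.
have -> : - (m.+1%:Z) = -1 - m%:Z by rewrite intS opprD.
by rewrite -addrA !TP IHm.
Qed.

(** * The Koopman action *)

Section Koopman.
Context (d : measure_display) (X : measurableType d) (R : realType).
Context (mu : probability X R) (T Tinv : X -> X) (aut : is_aut mu T Tinv).
Local Notation ip := (L2ip mu).
Local Notation N := (sqn ip).
Local Notation Tn := (Tpow T Tinv).
Implicit Types (A B : set X) (f g : L2 mu) (n : int).

Lemma measurable_iter (S : X -> X) k : measurable_fun setT S -> measurable_fun setT (iter k S).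
Proof.
move=> mS; elim: k => [|k IHk]; first exact: measurable_id.
exact: (measurableT_comp mS IHk).
Qed.

Lemma measurable_Tpow n : measurable_fun setT (Tn n).
Proof. by case: aut => mT mTi _ _ _; case: n => k; exact: measurable_iter. Qed.

Lemma measurable_Tpow_preimage n A : measurable A -> measurable (Tn n @^-1` A).
Proof. by move=> mA; rewrite -[_ @^-1` _]setTI; exact: measurable_Tpow. Qed.

Lemma Tpow_preserves n A : measurable A -> mu (Tn n @^-1` A) = mu A.
Proof.
have [mT mTi TK TiK Tmu] := aut.
have Timu B : measurable B -> mu (Tinv @^-1` B) = mu B.
  move=> mB; rewrite -(Tmu (Tinv @^-1` B)); last by rewrite -[_ @^-1` _]setTI; exact: mTi.
  by congr (mu _); apply/seteqP; split => x /=; rewrite TK.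
have it S : measurable_fun setT S -> (forall B, measurable B -> mu (S @^-1` B) = mu B) ->
    forall k B, measurable B -> mu (iter k S @^-1` B) = mu B.
  move=> mS Smu; elim=> // k IHk B mB.
  rewrite -[RHS]Smu// -[RHS]IHk; last by rewrite -[_ @^-1` _]setTI; exact: mS.
  by [].
by move=> mA; case: n => k; exact: it.
Qed.

Lemma integral_sqr_Tpow n (f : X -> R) : measurable_fun setT f ->
  (\int[mu]_x ((f (Tn n x)) ^+ 2)%:E = \int[mu]_x ((f x) ^+ 2)%:E)%E.
Proof.
move=> mf; have mTn := measurable_Tpow n.
have := @ge0_integral_pushforward _ _ X X R (Tn n) mTn mu setT (fun x => ((f x) ^+ 2)%:E)
  measurableT (measurable_sqr_EFin mf).
move=> /(_ _)/wrap[x _|]; first by rewrite lee_fin sqr_ge0.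
rewrite preimage_setT => <-; apply: eq_measure_integral => A mA _.
exact: Tpow_preserves.
Qed.

Lemma kact_measurable n f : measurable_fun setT (fun x => L2fun f (Tn n x)).
Proof. by apply: measurableT_comp; [exact: L2_measurable|exact: measurable_Tpow]. Qed.

Lemma kact_fin n f : (\int[mu]_x ((L2fun f (Tn n x)) ^+ 2)%:E < +oo)%E.
Proof. by rewrite integral_sqr_Tpow ?L2_measurable// -L2_sqnE ltry. Qed.

Definition kact n f : L2 mu := mkL2 (kact_measurable n f) (kact_fin n f).

Lemma kactE n f x : L2fun (kact n f) x = L2fun f (Tn n x).
Proof. by []. Qed.

Lemma kactD n f g : kact n (f + g) = kact n f + kact n g.
Proof. exact: L2P. Qed.

Lemma kactZ n a f : kact n (a *: f) = a *: kact n f.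
Proof. exact: L2P. Qed.

Lemma kactM m n f : kact m (kact n f) = kact (m + n) f.
Proof.
(* Composition reverses the order of the two powers, hence the commutation. *)
apply: L2P => x; rewrite !kactE addrC.
by have [_ _ TK TiK _] := aut; rewrite TpowD.
Qed.

Lemma kact0 f : kact 0 f = f.
Proof. exact: L2P. Qed.

Lemma kact_sqn n f : N (kact n f) = N f.
Proof.
by apply: EFin_inj; rewrite !L2_sqnE -[RHS](integral_sqr_Tpow n)//; exact: L2_measurable.
Qed.

Lemma kact_dot n f g : ip (kact n f) (kact n g) = ip f g.
Proof.
have := kact_sqn n (f + g); rewrite kactD !sqnD !kact_sqn; lra.
Qed.

Definition koopman : isometric_Zaction ip :=
  IsometricZaction kactD kactZ kactM kact0 kact_dot.

Lemma koopman_indL2 n A (mA : measurable A) :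
  koopman n (indL2 mu mA) = indL2 mu (measurable_Tpow_preimage n mA).
Proof. exact: L2P. Qed.

Lemma koopman_one n : koopman n (oneL2 mu) = oneL2 mu.
Proof. exact: L2P. Qed.

(** This is where distality enters: mu x mu is fixed on rectangles, and flight times bring the
    coupling twisted by f arbitrarily close to it. *)
Lemma distal_flight_null f : lens_distal mu T Tinv -> (forall x, `|L2fun f x| <= 1) ->
  ip f (oneL2 mu) = 0 -> flight koopman f -> N f = 0.
Proof.
move=> dist f1 fm flf; apply: contrapT => f0.
have [rho2 rho2E] := twisted_coupling f1 fm.
(* The product coupling is the twist by 0. *)
have [||rho1 rho1E] := @twisted_coupling _ _ _ mu 0.
- by move=> x; rewrite (_ : L2fun 0 x = 0)// normr0.
- by rewrite dot0l.
have oneT : ip (oneL2 mu) (oneL2 mu) = 1.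
  by apply: EFin_inj; rewrite dot_one_indL2 (probability_setT mu).
have coup (rho : probability (X * X)%type R) (g : L2 mu) : ip g (oneL2 mu) = 0 ->
    (forall A B (mA : measurable A) (mB : measurable B), rho (A `*` B) =
      (ip (oneL2 mu) (indL2 mu mA) * ip (oneL2 mu) (indL2 mu mB)
       + ip g (indL2 mu mA) * ip g (indL2 mu mB))%:E) -> coupling mu rho.
  move=> gm rhoE A mA; rewrite !(rhoE _ _ mA measurableT) !(rhoE _ _ measurableT mA).
  rewrite -/(oneL2 mu) oneT gm mulr0 mul0r !addr0 mulr1 mul1r.
  by split; exact: dot_one_indL2.
apply: (dist rho1 rho2).
- by apply: coup rho1E; rewrite dot0l.
- exact: coup rho2E.
(* The two couplings differ on squares A x A by <f, 1_A>^2, so their equality would make f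
   orthogonal to every indicator. *)
- apply: contrapT => h; apply: f0; apply: indL2_orth_null => A mA.
  have e12 : rho1 (A `*` A) = rho2 (A `*` A).
    by apply: contrapT => ne; apply: h; exists (A `*` A); split=> //; exact: measurableX.
  move: e12; rewrite (rho1E _ _ mA mA) (rho2E _ _ mA mA) dot0l mul0r.
  move: (ip _ _ * ip _ _) (ip f _) => x y [xy].
  have /eqP : y * y = 0 by lra.
  by rewrite mulf_eq0 orbb => /eqP.
exists rho1; split; first by apply: coup rho1E; rewrite dot0l.
(* The error on a rectangle is a product of two factors at most c, and c^2 <= c <= e/2 since c <=
   1. *)
move=> k A B e mAB e0; pose c := Num.min 1 (e / 2).
have c0 : 0 < c by rewrite lt_min ltr01/=; lra.
have c1 : c <= 1 by rewrite ge_min lexx.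
have ce : c <= e / 2 by rewrite ge_min lexx orbT.
have [n nP] := flf ([seq indL2 mu (mAB i).1 | i <- iota 0 k]
  ++ [seq indL2 mu (mAB i).2 | i <- iota 0 k]) c c0.
have pE C (mC : measurable C) : ip (oneL2 mu) (indL2 mu (measurable_Tpow_preimage n mC))
    = ip (oneL2 mu) (indL2 mu mC).
  by rewrite -koopman_indL2 -{1}(koopman_one n) act_dot.
exists n; split => i ik; rewrite /tilde_rect /rect.
  rewrite (rho1E _ _ (measurable_Tpow_preimage n (mAB i).1) (measurable_Tpow_preimage n (mAB i).2)).
  by rewrite (rho1E _ _ (mAB i).1 (mAB i).2) !pE !dot0l -EFinB subrr abse0 lte_fin.
rewrite (rho2E _ _ (measurable_Tpow_preimage n (mAB i).1) (measurable_Tpow_preimage n (mAB i).2)).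
rewrite (rho1E _ _ (mAB i).1 (mAB i).2) !pE !dot0l mulr0 addr0 -EFinB addrC addKr.
rewrite abse_EFin lte_fin normrM -!koopman_indL2.
have hA : `|ip f (koopman n (indL2 mu (mAB i).1))| <= c.
  by apply: nP; rewrite mem_cat; apply/orP; left; apply/mapP; exists i; rewrite ?mem_iota.
have hB : `|ip f (koopman n (indL2 mu (mAB i).2))| <= c.
  by apply: nP; rewrite mem_cat; apply/orP; right; apply/mapP; exists i; rewrite ?mem_iota.
have := normr_ge0 (ip f (koopman n (indL2 mu (mAB i).1))).
have := normr_ge0 (ip f (koopman n (indL2 mu (mAB i).2))).
by move: `|_| `|_| hA hB => x y *; nra.
Qed.

End Koopman.

(** * Truncation to [-1, 1] *)

Definition clip (R : realType) (x : R) := Num.max (-1) (Num.min 1 x).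

Lemma normr_clip_le1 (R : realType) (x : R) : `|clip x| <= 1.
Proof.
rewrite /clip ler_norml le_max lexx/= ge_max ge_min lexx /=.
by rewrite andbT; lra.
Qed.

Lemma clip_id (R : realType) (x : R) : `|x| <= 1 -> clip x = x.
Proof. by rewrite ler_norml => /andP[x1 x2]; rewrite /clip min_r// max_r. Qed.

Lemma clip_lipschitz (R : realType) (x y : R) : (clip x - clip y) ^+ 2 <= (x - y) ^+ 2.
Proof.
wlog xy : x y / x <= y => [hw|].
  have [|/ltW] := leP x y; first exact: hw.
  by move=> /hw; rewrite -[(clip y - _) ^+ 2]sqrrN -[(y - x) ^+ 2]sqrrN !opprB.
have cxy : clip x <= clip y <= clip x + (y - x).
  rewrite /clip /Num.max /Num.min.
  by case: (ltP 1 x); case: (ltP 1 y); do ?case: ifPn; rewrite -?leNgt => *; apply/andP; split; lra.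
move: (clip x) (clip y) cxy => a b /andP[ab ba]; nra.
Qed.

(** * Consequences of distality *)

Section AlmostPeriodicity.
Context (d : measure_display) (X : measurableType d) (R : realType).
Context (mu : probability X R) (T Tinv : X -> X) (aut : is_aut mu T Tinv).
Local Notation ip := (L2ip mu).
Local Notation N := (sqn ip).
Local Notation U := (koopman aut).
Local Notation Tn := (Tpow T Tinv).
Implicit Types (A B : set X) (f g : L2 mu) (n : int).

Lemma clip_measurable f : measurable_fun setT (fun x => clip (L2fun f x)).
Proof.
apply: measurable_maxr; first exact: measurable_cst.
by apply: measurable_minr; [exact: measurable_cst|exact: L2_measurable].
Qed.

Definition clipL2 f : L2 mu := mkL2 (clip_measurable f)
  (bounded_integral_sqr mu (clip_measurable f) (fun x => normr_clip_le1 (L2fun f x))).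

Lemma clipL2E f x : L2fun (clipL2 f) x = clip (L2fun f x). Proof. by []. Qed.

Lemma sqn_clipL2 f g : N (clipL2 f - clipL2 g) <= N (f - g).
Proof.
rewrite -lee_fin !L2_sqnE; apply: ge0_le_integral => //.
- by move=> x _; rewrite lee_fin sqr_ge0.
- by apply: measurable_sqr_EFin; exact: L2_measurable.
- by apply: measurable_sqr_EFin; exact: L2_measurable.
- by move=> x _; rewrite lee_fin !L2_funB !clipL2E; exact: clip_lipschitz.
Qed.

(** Truncation is pointwise and 1-Lipschitz, so it commutes with U and contracts the L^2
    distance. *)
Lemma almost_periodic_clip f : almost_periodic U f -> almost_periodic U (clipL2 f).
Proof.
apply: (@tot_bounded_lipschitz _ _ _ _ _ 1 clipL2); first exact: ltr01.
  by move=> u v; rewrite mul1r; exact: sqn_clipL2.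
move=> _ [n _ <-]; exists (U n f); first by exists n.
rewrite (_ : U n (clipL2 f) = clipL2 (U n f)); last exact: L2P.
by rewrite subrr /sqn dot0l.
Qed.

Lemma almost_periodic_one : almost_periodic U (oneL2 mu).
Proof.
move=> e e0; exists [:: oneL2 mu] => _ [n _ <-]; exists (oneL2 mu); rewrite ?mem_head//.
by rewrite koopman_one subrr /sqn dot0l ltW.
Qed.

Lemma almost_periodic_sqn0 f g : N (f - g) = 0 -> almost_periodic U g -> almost_periodic U f.
Proof.
by move=> fg apg; apply: almost_periodic_closed => e e0; exists g => //; rewrite fg ltW.
Qed.

(* Clipping the projection p of f to [-1, 1] stays in the space of almost periodic
   functions and does not move it away from f, so that p is already bounded. *)
Lemma distal_bounded_almost_periodic f : lens_distal mu T Tinv ->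
  (forall x, `|L2fun f x| <= 1) -> almost_periodic U f.
Proof.
move=> dist f1; have Vc : complete_sqn ip by exact: L2_complete.
have [p app pP] := orthogonal_projection f Vc (almost_periodic_subspace U)
  (@almost_periodic_closed _ _ _ U).
have apq := almost_periodic_clip app.
have fE : clipL2 f = f by apply: L2P => x; rewrite clipL2E clip_id.
(* f - p is orthogonal to p - clip p, so Pythagoras gives N(f - clip p) = N(f - p) + N(p - clip p),
   while contraction bounds the left side by N(f - p). *)
have pq : N (p - clipL2 p) = 0.
  have := sqn_clipL2 f p; rewrite fE.
  have -> : f - clipL2 p = (f - p) + (p - clipL2 p) by rewrite addrA subrK.
  rewrite sqnD pP; last exact: subspaceB (almost_periodic_subspace U) _ _.
  by have := sqn_ge0 ip (p - clipL2 p); lra.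
have gP m : almost_periodic U m -> ip (f - clipL2 p) m = 0.
  move=> apm; have -> : f - clipL2 p = (f - p) + (p - clipL2 p) by rewrite addrA subrK.
  by rewrite dotDl pP// dot_sqn0l// addr0.
apply: (almost_periodic_sqn0 _ apq).
(* f - clip p is bounded by 2; halving it meets the bound 1 required of a twist. *)
suff : N (2^-1 *: (f - clipL2 p)) = 0.
  by rewrite sqnZ => /eqP; rewrite mulf_eq0 expf_eq0/= invr_eq0 pnatr_eq0/= => /eqP.
apply: (distal_flight_null dist).
- move=> x; rewrite L2_funZ L2_funB clipL2E.
  have := f1 x; have := normr_clip_le1 (L2fun p x).
  by move: (L2fun f x) (clip _) => a b; rewrite !ler_norml => *; apply/andP; split; lra.
- by rewrite dotZl gP ?mulr0//; exact: almost_periodic_one.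
- apply: orthogonal_almost_periodic_flight => // m apm.
  by rewrite dotZl gP ?mulr0.
Qed.

(** Indicators are bounded, hence almost periodic; the component of f orthogonal to the almost
    periodic vectors is orthogonal to all of them and so null. *)
Lemma distal_almost_periodic f : lens_distal mu T Tinv -> almost_periodic U f.
Proof.
move=> dist; have Vc : complete_sqn ip by exact: L2_complete.
have [p app pP] := orthogonal_projection f Vc (almost_periodic_subspace U)
  (@almost_periodic_closed _ _ _ U).
apply: (almost_periodic_sqn0 _ app); apply: indL2_orth_null => A mA; apply: pP.
apply: distal_bounded_almost_periodic => // x.
by rewrite indL2E normr_indic_le1.
Qed.

Lemma orbit_net f (e : R) : almost_periodic U f -> 0 < e ->
  exists s : seq int, forall n, exists2 j, j \in s & N (U n f - U j f) <= e.
Proof.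
move=> apf e0; have e4 : 0 < e / 4 by lra.
have [t tP] := apf _ e4.
have /choice[c cP] : forall v, exists j, (exists n, N (U n f - v) <= e / 4) ->
    N (U j f - v) <= e / 4.
  move=> v; have [[j jP]|nj] := pselect (exists n, N (U n f - v) <= e / 4).
    by exists j.
  by exists 0 => /nj.
exists [seq c v | v <- t] => n; have [|v vt nv] := tP (U n f); first by exists n.
exists (c v); first exact: map_f.
have := sqn_triangle ip v (U n f) (U (c v) f); rewrite [N (v - _)]sqnB.
by have := cP v (ex_intro _ n nv); lra.
Qed.

End AlmostPeriodicity.

(** * Equicontinuity of the lens *)

Section Equicontinuity.
Context (d : measure_display) (X : measurableType d) (R : realType).
Context (mu : probability X R).
Local Notation N := (sqn (L2ip mu)).
Implicit Types (A B : set X).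

Lemma mu_setD_le A A' (mA : measurable A) (mA' : measurable A') :
  (mu (A `\` A') <= (N (indL2 mu mA - indL2 mu mA'))%:E)%E.
Proof.
have mD : measurable (A `\` A') by exact: measurableD.
rewrite L2_sqnE -[leLHS]mul1e -integral_cst// integral_mkcond.
apply: ge0_le_integral => //.
- by move=> x _; rewrite patchE; case: ifP.
- by apply/(measurable_restrictT _ mD); exact: measurable_cst.
- by apply: measurable_sqr_EFin; exact: L2_measurable.
- move=> x _; rewrite patchE L2_funB !indL2E; case: ifPn => [|_]; last first.
    by rewrite lee_fin sqr_ge0.
  by rewrite inE => -[Ax nAx]; rewrite !indicE mem_set// memNset// subr0 expr1n.
Qed.

(** A x B is covered by A' x B', a vertical strip over A \ A' and a horizontal strip over B \ B'.
    The marginals fix the mass of the strips, so the estimate is uniform over all couplings. *)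
Lemma coupling_rect_le (rho : probability (X * X)%type R) A A' B B'
    (mA : measurable A) (mA' : measurable A') (mB : measurable B) (mB' : measurable B') :
  coupling mu rho ->
  fine (rho (A `*` B)) <= fine (rho (A' `*` B')) +
    (N (indL2 mu mA - indL2 mu mA') + N (indL2 mu mB - indL2 mu mB')).
Proof.
move=> crho; have fin E : measurable E -> rho E \is a fin_num.
  by move=> mE; exact: fin_num_measure.
have mAD : measurable (A `\` A') by exact: measurableD.
have mBD : measurable (B `\` B') by exact: measurableD.
rewrite -lee_fin fineK; last by apply: fin; exact: measurableX.
rewrite !EFinD fineK; last by apply: fin; exact: measurableX.
have sub : A `*` B `<=` (A' `*` B') `|` (((A `\` A') `*` setT) `|` (setT `*` (B `\` B'))).
  move=> [x y] [/= Ax By]; have [A'x|] := pselect (A' x); last by right; left.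
  by have [B'y|] := pselect (B' y); [left|right; right].
apply: (@le_trans _ _ (rho ((A' `*` B') `|` (((A `\` A') `*` setT) `|` (setT `*` (B `\` B')))))).
  apply: le_measure => //; rewrite inE; first exact: measurableX.
  by do !apply: measurableU; exact: measurableX.
apply: le_trans (measureU2 _ _ _) _; [exact: measurableX| |].
  by apply: measurableU; exact: measurableX.
rewrite leeD2l//; apply: le_trans (measureU2 _ _ _) _; [exact: measurableX..|].
have [hA _] := crho _ mAD; have [_ hB] := crho _ mBD.
by apply: leeD; [rewrite [leLHS]hA|rewrite [leLHS]hB]; exact: mu_setD_le.
Qed.

(** Precompact orbits of indicators put T^-n A x T^-n B, for every n, near one of finitely many
    rectangles T^-j A x T^-l B; agreement of two couplings on these controls all times at once.
    Replacing the rectangle costs e/4 for each coupling, and the finite family contributes e/2. *)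
Lemma almost_periodic_equicontinuous (T Tinv : X -> X) (aut : is_aut mu T Tinv) :
  (forall f, almost_periodic (koopman aut) f) -> lens_equicontinuous mu T Tinv.
Proof.
move=> ap rho crho k A B e mAB e0.
have e8 : 0 < e / 8 by lra.
have /choice[s sP] := fun i => orbit_net (ap (indL2 mu (mAB i).1)) e8.
have /choice[t tP] := fun i => orbit_net (ap (indL2 mu (mAB i).2)) e8.
(* The times j and l are chosen independently for the two sides, hence the product of the two
   nets. *)
pose Q := [seq (i, jl) | i <- iota 0 k, jl <- [seq (j, l) | j <- s i, l <- t i]].
(* Beyond [size Q] the default only has to yield measurable sets. *)
pose q m := nth (0%N, (0 : int, 0 : int)) Q m.
pose A' m := Tpow T Tinv (q m).2.1 @^-1` A (q m).1.
pose B' m := Tpow T Tinv (q m).2.2 @^-1` B (q m).1.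
exists (size Q), A', B', (e / 2); split; [|lra|].
  move=> m; have mTn := measurable_Tpow_preimage aut.
  by split; apply: mTn; [exact: (mAB _).1|exact: (mAB _).2].
move=> rho' crho' near_rho n i ik.
have [j js nj] := sP i n; have [l lt nl] := tP i n.
have tQ : (i, (j, l)) \in Q.
  apply/allpairsPdep; exists i, (j, l); rewrite mem_iota; split=> //.
  by apply/allpairsP; exists (j, l).
have := near_rho (index (i, (j, l)) Q); rewrite index_mem => /(_ tQ).
rewrite /A' /B' /q nth_index//= /rect /tilde_rect.
have mAT m := measurable_Tpow_preimage aut m (mAB i).1.
have mBT m := measurable_Tpow_preimage aut m (mAB i).2.
have fin (r : probability (X * X)%type R) E : measurable E -> r E = (fine (r E))%:E.
  by move=> mE; rewrite fineK//; exact: fin_num_measure.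
have mnn := measurableX (mAT n) (mBT n); have mjl := measurableX (mAT j) (mBT l).
rewrite (fin rho _ mnn) (fin rho' _ mnn) (fin rho _ mjl) (fin rho' _ mjl).
rewrite -!EFinB !abse_EFin !lte_fin.
rewrite !koopman_indL2 in nj; rewrite !koopman_indL2 in nl.
have := coupling_rect_le (mAT n) (mAT j) (mBT n) (mBT l) crho.
have := coupling_rect_le (mAT j) (mAT n) (mBT l) (mBT n) crho.
have := coupling_rect_le (mAT n) (mAT j) (mBT n) (mBT l) crho'.
have := coupling_rect_le (mAT j) (mAT n) (mBT l) (mBT n) crho'.
rewrite [N (indL2 mu (mAT j) - _)]sqnB [N (indL2 mu (mBT l) - _)]sqnB.
by rewrite !ltr_norml => *; apply/andP; split; lra.
Qed.

End Equicontinuity.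

(** * Complex linear combinations of eigenfunctions *)

Section EigenCombinations.
Context (d : measure_display) (X : measurableType d) (R : realType).
Context (mu : probability X R) (T : X -> X).
Implicit Types (g h : X -> R).

Definition eigen_comb (g1 g2 : X -> R) := exists k (f1 f2 : nat -> X -> R) (c dd : nat -> R),
  (forall i, (i < k)%N -> eigenfunction mu T (f1 i) (f2 i)) /\
  forall x, g1 x = \sum_(i < k) (c i * f1 i x - dd i * f2 i x) /\
            g2 x = \sum_(i < k) (c i * f2 i x + dd i * f1 i x).

Lemma eigen_comb0 : eigen_comb (fun=> 0) (fun=> 0).
Proof.
exists 0%N, (fun _ _ => 0), (fun _ _ => 0), (fun=> 0), (fun=> 0).
by split=> // x; rewrite !big_ord0.
Qed.

Lemma eigen_comb_ext g1 g2 h1 h2 : (forall x, g1 x = h1 x) -> (forall x, g2 x = h2 x) ->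
  eigen_comb g1 g2 -> eigen_comb h1 h2.
Proof. by move=> /funext -> /funext ->. Qed.

Lemma eigen_combD g1 g2 h1 h2 : eigen_comb g1 g2 -> eigen_comb h1 h2 ->
  eigen_comb (fun x => g1 x + h1 x) (fun x => g2 x + h2 x).
Proof.
move=> [k [f1 [f2 [c [dd [fP gE]]]]]] [k' [f1' [f2' [c' [dd' [fP' hE]]]]]].
pose J (S : Type) (F F' : nat -> S) i := if (i < k)%N then F i else F' (i - k)%N.
exists (k + k')%N, (J _ f1 f1'), (J _ f2 f2'), (J _ c c'), (J _ dd dd'); split.
  move=> i ik; rewrite /J; case: ltnP => ki; first exact: fP.
  by apply: fP'; rewrite ltn_subLR.
move=> x; have [-> ->] := gE x; have [-> ->] := hE x; rewrite !big_split_ord /=.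
have Jl S (F F' : nat -> S) (i : 'I_k) : J S F F' i = F i by rewrite /J ltn_ord.
have Jr S (F F' : nat -> S) (i : 'I_k') : J S F F' (k + i)%N = F' i.
  by rewrite /J ltnNge leq_addr addKn.
by split; congr (_ + _); apply: eq_bigr => i _; rewrite ?Jl ?Jr.
Qed.

Lemma eigen_combZ (a b : R) g1 g2 : eigen_comb g1 g2 ->
  eigen_comb (fun x => a * g1 x - b * g2 x) (fun x => a * g2 x + b * g1 x).
Proof.
move=> [k [f1 [f2 [c [dd [fP gE]]]]]].
exists k, f1, f2, (fun i => a * c i - b * dd i), (fun i => a * dd i + b * c i).
split=> // x; have [-> ->] := gE x; rewrite !mulr_sumr -sumrB -big_split /=.
by split; apply: eq_bigr => i _; ring.
Qed.

Lemma eigenfunction_conj h1 h2 : eigenfunction mu T h1 h2 ->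
  eigenfunction mu T h1 (fun x => - h2 x).
Proof.
move=> [[m1 m2 fin] n0 [a [b ab]]]; split.
- split=> //; first exact: measurable_funN.
  by under eq_integral do rewrite sqrrN.
- move=> h0; apply: n0; apply: filterS h0 => x [h10 /eqP].
  by rewrite oppr_eq0 => /eqP.
- exists a, (- b); apply: filterS ab => x [-> ->].
  by split; ring.
Qed.

Lemma eigen_comb_eigenfunction h1 h2 : eigenfunction mu T h1 h2 -> eigen_comb h1 h2.
Proof.
move=> h; exists 1%N, (fun=> h1), (fun=> h2), (fun=> 1), (fun=> 0); split=> // x.
by rewrite !big_ord1; split; ring.
Qed.

(** Half the sum of the eigenfunction and its conjugate, which is again an eigenfunction. *)
Lemma eigen_comb_real_part h1 h2 : eigenfunction mu T h1 h2 -> eigen_comb h1 (fun=> 0).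
Proof.
move=> h; have h' := eigenfunction_conj h.
have := eigen_combD (eigen_combZ 2^-1 0 (eigen_comb_eigenfunction h))
  (eigen_combZ 2^-1 0 (eigen_comb_eigenfunction h')).
by apply: eigen_comb_ext => x; field.
Qed.

End EigenCombinations.

(** * Density of the span of the eigenfunctions *)

Section DiscreteSpectrum.
Context (d : measure_display) (X : measurableType d) (R : realType).
Context (mu : probability X R) (T Tinv : X -> X) (aut : is_aut mu T Tinv).
Local Notation ip := (L2ip mu).
Local Notation N := (sqn ip).
Local Notation U := (koopman aut).
Implicit Types (f g h : L2 mu).

(** Asking for combinations with imaginary part exactly 0 gives a subspace of the real space, and
    approximation is built in so that it is closed: the real projection theorem applies to it. *)
Definition eigen_span : set (L2 mu) := [set f | forall e : R, 0 < e ->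
  exists2 h, eigen_comb mu T (L2fun h) (fun=> 0) & N (f - h) <= e].

Lemma eigen_span_comb h : eigen_comb mu T (L2fun h) (fun=> 0) -> eigen_span h.
Proof. by move=> ch e e0; exists h => //; rewrite subrr /sqn dot0l ltW. Qed.

Lemma eigen_span_subspace : subspace eigen_span.
Proof.
split.
  by apply: eigen_span_comb; apply: eigen_comb_ext (eigen_comb0 mu T).
move=> a u v Eu Ev e e0; have a0 := sqr_ge0 a.
have c0 : 0 < e / (4 * (a ^+ 2 + 1)) by rewrite divr_gt0// mulr_gt0//; lra.
have e4 : 0 < e / 4 by lra.
have [h hc uh] := Eu _ c0; have [h' hc' vh'] := Ev _ e4.
exists (a *: h + h').
  apply: eigen_comb_ext (eigen_combD (eigen_combZ a 0 hc) hc') => x.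
    by rewrite L2_funD L2_funZ; ring.
  by ring.
have -> : a *: u + v - (a *: h + h') = a *: (u - h) + (v - h').
  by rewrite scalerBr opprD addrACA.
apply: le_trans (sqnD_le _ _ _) _; rewrite sqnZ.
have : (a ^+ 2 + 1) * N (u - h) <= e / 4.
  have -> : e / 4 = (a ^+ 2 + 1) * (e / (4 * (a ^+ 2 + 1))) by field; rewrite gt_eqF//; lra.
  by rewrite ler_pM2l//; lra.
by have := sqn_ge0 ip (u - h); lra.
Qed.

Lemma eigen_span_closed : closed_sqn ip eigen_span.
Proof.
move=> v vE e e0; have e4 : 0 < e / 4 by lra.
have [w Ew vw] := vE _ e4; have [h hc wh] := Ew _ e4; exists h => //.
by have := sqn_triangle ip w v h; lra.
Qed.

Lemma integral_sqrD (f1 f2 : X -> R) : measurable_fun setT f1 -> measurable_fun setT f2 ->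
  (\int[mu]_x ((f1 x) ^+ 2 + (f2 x) ^+ 2)%:E
   = \int[mu]_x ((f1 x) ^+ 2)%:E + \int[mu]_x ((f2 x) ^+ 2)%:E)%E.
Proof.
move=> m1 m2; under eq_integral do rewrite EFinD.
by rewrite ge0_integralD//;
  first [exact: measurable_sqr_EFin|by move=> x _; rewrite lee_fin sqr_ge0].
Qed.

Lemma eigenpair_eigenfunction h1 h2 : eigenpair U h1 h2 -> N h1 <> 0 ->
  eigenfunction mu T (L2fun h1) (L2fun h2).
Proof.
move=> [a [b [e1 e2]]] n0; split.
- split; [exact: L2_measurable..|].
  rewrite integral_sqrD; [|exact: L2_measurable..].
  by rewrite -!L2_sqnE -EFinD ltry.
- by move=> h0; apply: n0; apply: L2_ae_sqn0; apply: filterS h0 => x [].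
- exists a, b; apply: filterS2 (L2_sqn0_ae e1) (L2_sqn0_ae e2) => x.
  rewrite !L2_funB L2_funD !L2_funZ.
  have UE h : L2fun (U 1 h) x = L2fun h (T x) by [].
  by rewrite !UE => /eqP; rewrite subr_eq0 => /eqP -> /eqP; rewrite subr_eq0 => /eqP ->.
Qed.

Lemma eigen_span_full f : (forall f, almost_periodic U f) -> eigen_span f.
Proof.
move=> ap; have Vc : complete_sqn ip by exact: L2_complete.
have [p Ep pP] := orthogonal_projection f Vc eigen_span_subspace eigen_span_closed.
apply: eigen_span_closed => e e0; exists p => //.
rewrite (@almost_periodic_eigen_orth_null _ _ _ U (f - p))//; first exact: ltW.
(* An eigenfunction must not vanish almost everywhere; when h1 is null the orthogonality is
   automatic. *)
move=> h1 h2 h12; have [h10|h10] := pselect (N h1 = 0); first exact: dot_sqn0r.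
apply: pP; apply: eigen_span_comb.
exact: eigen_comb_real_part (eigenpair_eigenfunction h12 h10).
Qed.

Lemma almost_periodic_discrete_spectrum : (forall f, almost_periodic U f) ->
  discrete_spectrum mu T.
Proof.
move=> ap g1 g2 [m1 m2 gfin] e e0.
have le_fin (f1 f2 : X -> R) : measurable_fun setT f1 -> measurable_fun setT f2 ->
    (\int[mu]_x ((f1 x) ^+ 2 + (f2 x) ^+ 2)%:E < +oo)%E ->
    (\int[mu]_x ((f1 x) ^+ 2)%:E < +oo)%E.
  move=> mf1 mf2; apply: le_lt_trans; rewrite integral_sqrD// leeDl//.
  by apply: integral_ge0 => x _; rewrite lee_fin sqr_ge0.
have fin1 := le_fin _ _ m1 m2 gfin.
have fin2 : (\int[mu]_x ((g2 x) ^+ 2)%:E < +oo)%E.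
  by apply: (le_fin _ _ m2 m1); under eq_integral do rewrite addrC.
have e4 : 0 < e / 4 by lra.
have [h1 c1 n1] := eigen_span_full (mkL2 m1 fin1) ap e4.
have [h2 c2 n2] := eigen_span_full (mkL2 m2 fin2) ap e4.
(* Real and imaginary parts were approximated separately; the scalars 0 and 1 multiply the second
   combination by i. *)
have : eigen_comb mu T (L2fun h1) (L2fun h2).
  apply: eigen_comb_ext (eigen_combD c1 (eigen_combZ 0 1 c2)) => x; ring.
move=> [k [f1 [f2 [c [dd [fP hE]]]]]]; exists k, f1, f2, c, dd; split=> //.
rewrite (eq_integral (fun x => ((L2fun (mkL2 m1 fin1 - h1) x) ^+ 2
    + (L2fun (mkL2 m2 fin2 - h2) x) ^+ 2)%:E)); last first.
  by move=> x _; rewrite !L2_funB; have [-> ->] := hE x.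
rewrite integral_sqrD; [|exact: L2_measurable..].
by rewrite -!L2_sqnE -EFinD lte_fin; lra.
Qed.

End DiscreteSpectrum.

Theorem mainTheorem5 (d : measure_display) (X : measurableType d) (R : realType)
  (mu : probability X R) (T Tinv : X -> X) :
  standard_borel X R ->
  is_aut mu T Tinv ->
  ergodic mu T ->
  lens_distal mu T Tinv ->
  discrete_spectrum mu T /\ lens_equicontinuous mu T Tinv.
Proof.
move=> _ aut _ dist.
have ap f : almost_periodic (koopman aut) f by exact: distal_almost_periodic.
by split; [exact: almost_periodic_discrete_spectrum ap|exact: almost_periodic_equicontinuous ap].
Qed.
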